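(* The satisfiability problem for $\mathrm{HyperQPTL}$ (given a $\mathrm{HyperQPTL}$ sentence $\phi$, decide whether there exists a nonempty set $T$ of traces with $T\models\phi$) is $\Sigma^2_1$-complete.
   Context: Let $\mathrm{AP}$ be a nonempty finite set of atomic propositions. A trace over $\mathrm{AP}$ is an infinite word $t=t(0)t(1)\cdots$ over the alphabet $2^{\mathrm{AP}}$. Let $\mathcal{V}$ be a countable set of trace variables. $\mathrm{HyperQPTL}$ formulas are given by the grammar $\phi ::= \exists \pi.\,\phi \mid \forall \pi.\,\phi \mid \exists q.\,\phi \mid \forall q.\,\phi \mid \psi$, $\psi ::= p_\pi \mid q \mid \neg\psi \mid \psi\vee\psi \mid \mathbf{X}\psi \mid \mathbf{F}\psi$, with $p,q\in\mathrm{AP}$ and $\pi\in\mathcal{V}$. A sentence is a formula in which every $p_\pi$ lies in the scope of a quantifier binding $\pi$ and every unlabeled $q$ lies in the scope of a quantifier binding $q$. For a trace $t$ and a trace $t_q$ over $\{q\}$, $t[q\mapsto t_q]$ is $t$ with the truth values of $q$ replaced by those of $t_q$; $T[q\mapsto t_q]=\{t[q\mapsto t_q]\mid t\in T\}$. Semantics, for a set $T$ of traces, partial map $\Pi:\mathcal{V}\to(2^{\mathrm{AP}})^\omega$, and $i\in\mathbb{N}$: $T,\Pi,i\models p_\pi$ iff $p\in\Pi(\pi)(i)$; $T,\Pi,i\models q$ iff $q\in t(i)$ for all $t\in T$; Boolean connectives as usual; $\mathbf{X}\psi$ holds at $i$ iff $\psi$ holds at $i+1$; $\mathbf{F}\psi$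 holds at $i$ iff $\psi$ holds at some $i'\ge i$; $\exists\pi.\phi$ / $\forall\pi.\phi$ quantify over $t\in T$ updating $\Pi[\pi\mapsto t]$; $\exists q.\phi$ / $\forall q.\phi$ quantify over $t_q\in(2^{\{q\}})^\omega$, evaluating $\phi$ over $T[q\mapsto t_q]$. $T\models\phi$ means $T,\Pi_\emptyset,0\models\phi$. $\Sigma^2_1$ is the class of sets of the form $\{n\in\mathbb{N}\mid (\mathbb{N},+,\cdot,<,\in)\models\phi(n)\}$ where $\phi(x)=\exists\mathcal{Y}_1\ldots\exists\mathcal{Y}_k.\,\psi$ with $\mathcal{Y}_j$ third-order variables and $\psi$ containing only first- and second-order quantifiers. $\Sigma^2_1$-complete means: in $\Sigma^2_1$ and every $\Sigma^2_1$ set is polynomial-time many-one reducible to it. *)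

(* Defs.v *)
From Corelib Require Import PosDef.
From HB Require Import structures.
From mathcomp Require Import all_boot.
From mathcomp Require Import classical_sets.

Set Implicit Arguments.
Unset Strict Implicit.
Unset Printing Implicit Defensive.

Local Open Scope classical_set_scope.

Definition update (A : Type) (f : nat -> A) (x : nat) (a : A) : nat -> A :=
  fun y => if y == x then a else f y.

Definition trace (AP : finType) := nat -> {set AP}.

(* Trace variables are natural numbers. *)
Inductive qfree (AP : finType) : Type :=
| QLab of AP & nat  (* p_pi *)
| QProp of AP       (* unlabeled q *)
| QNeg of qfree AP
| QOr of qfree AP & qfree AP
| QNext of qfree AP
| QEventually of qfree AP.

Inductive hyperqptl (AP : finType) : Type :=
| HExTrace of nat & hyperqptl AP
| HAllTrace of nat & hyperqptl AP
| HExProp of AP & hyperqptl AP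
| HAllProp of AP & hyperqptl AP
| HQfree of qfree AP.

Section Hyperqptl.
Variable AP : finType.
Implicit Types (T : set (trace AP)) (Pi : nat -> option (trace AP)).

Fixpoint qfree_closed (vs : seq nat) (qs : seq AP) (psi : qfree AP) : bool :=
  match psi with
  | QLab _ v => v \in vs
  | QProp q => q \in qs
  | QNeg psi1 => qfree_closed vs qs psi1
  | QOr psi1 psi2 => qfree_closed vs qs psi1 && qfree_closed vs qs psi2
  | QNext psi1 => qfree_closed vs qs psi1
  | QEventually psi1 => qfree_closed vs qs psi1
  end.

Fixpoint hyperqptl_closed (vs : seq nat) (qs : seq AP) (phi : hyperqptl AP)
    : bool :=
  match phi with
  | HExTrace v phi1 | HAllTrace v phi1 => hyperqptl_closed (v :: vs) qs phi1
  | HExProp q phi1 | HAllProp q phi1 => hyperqptl_closed vs (q :: qs) phi1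
  | HQfree psi => qfree_closed vs qs psi
  end.

Definition sentence (phi : hyperqptl AP) : bool :=
  hyperqptl_closed [::] [::] phi.

(* A trace tq over {q} is given by its truth values: tq i iff q holds at i. *)
Definition trace_subst (q : AP) (tq : nat -> bool) (t : trace AP) : trace AP :=
  fun i => if tq i then q |: t i else t i :\ q.

Fixpoint qfree_sat T Pi (i : nat) (psi : qfree AP) : Prop :=
  match psi with
  | QLab p v => exists2 t, Pi v = Some t & p \in t i
  | QProp q => forall t, T t -> q \in t i
  | QNeg psi1 => ~ qfree_sat T Pi i psi1
  | QOr psi1 psi2 => qfree_sat T Pi i psi1 \/ qfree_sat T Pi i psi2
  | QNext psi1 => qfree_sat T Pi i.+1 psi1
  | QEventually psi1 => exists2 j, i <= j & qfree_sat T Pi j psi1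
  end.

Fixpoint hyperqptl_sat T Pi (i : nat) (phi : hyperqptl AP) : Prop :=
  match phi with
  | HExTrace v phi1 =>
      exists2 t, T t & hyperqptl_sat T (update Pi v (Some t)) i phi1
  | HAllTrace v phi1 =>
      forall t, T t -> hyperqptl_sat T (update Pi v (Some t)) i phi1
  | HExProp q phi1 =>
      exists tq : nat -> bool,
        hyperqptl_sat (trace_subst q tq @` T) Pi i phi1
  | HAllProp q phi1 =>
      forall tq : nat -> bool,
        hyperqptl_sat (trace_subst q tq @` T) Pi i phi1
  | HQfree psi => qfree_sat T Pi i psi
  end.

Definition models T (phi : hyperqptl AP) : Prop :=
  hyperqptl_sat T (fun=> None) 0 phi.

Definition satisfiable (phi : hyperqptl AP) : Prop :=
  exists2 T : set (trace AP), T !=set0 & models T phi.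

End Hyperqptl.

(* Polish notation; propositions in 'I_m.+1 are read as natural numbers. *)
Fixpoint qfree_polish m (psi : qfree 'I_m.+1) : seq nat :=
  match psi with
  | QLab p v => [:: 0; val p; v]
  | QProp q => [:: 1; val q]
  | QNeg psi1 => 2 :: qfree_polish psi1
  | QOr psi1 psi2 => 3 :: qfree_polish psi1 ++ qfree_polish psi2
  | QNext psi1 => 4 :: qfree_polish psi1
  | QEventually psi1 => 5 :: qfree_polish psi1
  end.

Fixpoint hyperqptl_polish m (phi : hyperqptl 'I_m.+1) : seq nat :=
  match phi with
  | HExTrace v phi1 => [:: 6, v & hyperqptl_polish phi1]
  | HAllTrace v phi1 => [:: 7, v & hyperqptl_polish phi1]
  | HExProp q phi1 => [:: 8, val q & hyperqptl_polish phi1]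
  | HAllProp q phi1 => [:: 9, val q & hyperqptl_polish phi1]
  | HQfree psi => qfree_polish psi
  end.

Definition unary (n : nat) : seq bool := rcons (nseq n true) false.

(* The number whose binary expansion is w (least significant bit first)
   followed by a most significant digit 1, so that trailing zeros of w count. *)
Definition nat_of_word (w : seq bool) : nat :=
  foldr (fun (b : bool) n => b + n.*2) 1 w.

(* The set AP = {0, ..., m} is part of the coded instance. *)
Definition hyperqptl_code m (phi : hyperqptl 'I_m.+1) : nat :=
  nat_of_word (flatten (map unary (m :: hyperqptl_polish phi))).

Definition hyperqptl_satisfiability : set nat :=
  [set n | exists m (phi : hyperqptl 'I_m.+1),
     [/\ sentence phi, n = hyperqptl_code phi & satisfiable phi]].

Inductive term : Type :=
| TVar of nat
| TAdd of term & term
| TMul of term & term.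

(* Formulas of third-order arithmetic without third-order quantifiers, with
   third-order variables Y_0, ..., Y_(k-1); first- and second-order variables
   are named by natural numbers. *)
Inductive arith (k : nat) : Type :=
| AEq of term & term
| ALt of term & term
| AIn2 of term & nat
| AIn3 of nat & 'I_k
| ANeg of arith k
| AOr of arith k & arith k
| AEx1 of nat & arith k
| AAll1 of nat & arith k
| AEx2 of nat & arith k
| AAll2 of nat & arith k.

Fixpoint term_closed (xs : seq nat) (t : term) : bool :=
  match t with
  | TVar x => x \in xs
  | TAdd t1 t2 | TMul t1 t2 => term_closed xs t1 && term_closed xs t2
  end.

Fixpoint term_eval (e1 : nat -> nat) (t : term) : nat :=
  match t with
  | TVar x => e1 x
  | TAdd t1 t2 => term_eval e1 t1 + term_eval e1 t2
  | TMul t1 t2 => term_eval e1 t1 * term_eval e1 t2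
  end.

Section Arith.
Variable k : nat.

Fixpoint arith_closed (xs Xs : seq nat) (psi : arith k) : bool :=
  match psi with
  | AEq t1 t2 | ALt t1 t2 => term_closed xs t1 && term_closed xs t2
  | AIn2 t X => term_closed xs t && (X \in Xs)
  | AIn3 X _ => X \in Xs
  | ANeg psi1 => arith_closed xs Xs psi1
  | AOr psi1 psi2 => arith_closed xs Xs psi1 && arith_closed xs Xs psi2
  | AEx1 x psi1 | AAll1 x psi1 => arith_closed (x :: xs) Xs psi1
  | AEx2 X psi1 | AAll2 X psi1 => arith_closed xs (X :: Xs) psi1
  end.

Fixpoint arith_sat (e1 : nat -> nat) (e2 : nat -> set nat)
    (e3 : 'I_k -> set (set nat)) (psi : arith k) : Prop :=
  match psi with
  | AEq t1 t2 => term_eval e1 t1 = term_eval e1 t2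
  | ALt t1 t2 => term_eval e1 t1 < term_eval e1 t2
  | AIn2 t X => e2 X (term_eval e1 t)
  | AIn3 X Y => e3 Y (e2 X)
  | ANeg psi1 => ~ arith_sat e1 e2 e3 psi1
  | AOr psi1 psi2 => arith_sat e1 e2 e3 psi1 \/ arith_sat e1 e2 e3 psi2
  | AEx1 x psi1 => exists a, arith_sat (update e1 x a) e2 e3 psi1
  | AAll1 x psi1 => forall a, arith_sat (update e1 x a) e2 e3 psi1
  | AEx2 X psi1 => exists A, arith_sat e1 (update e2 X A) e3 psi1
  | AAll2 X psi1 => forall A, arith_sat e1 (update e2 X A) e3 psi1
  end.

End Arith.

(* The only free first-order variable of psi is 0. *)
Definition Sigma21 (A : set nat) : Prop :=
  exists k (psi : arith k), arith_closed [:: 0] [::] psi /\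
    A = [set n | exists Y : 'I_k -> set (set nat),
           arith_sat (update (fun=> 0) 0 n) (fun=> set0) Y psi].

(* Binary expansion without leading zeros, least significant bit first. *)
Fixpoint bits_of_pos (p : positive) : seq bool :=
  match p with
  | xH => [:: true]
  | xO p1 => false :: bits_of_pos p1
  | xI p1 => true :: bits_of_pos p1
  end.

Definition bits (n : nat) : seq bool :=
  if bin_of_nat n is Npos p then bits_of_pos p else [::].

Variant move := MoveLeft | MoveStay | MoveRight.

(* Deterministic Turing machines with ntapes.+1 one-way infinite tapes. The
   tape alphabet consists of the blank None, the bits Some (inl b), and
   auxiliary symbols Some (inr a). The input is on tape ord0 and the output on
   tape ord_max (the same tape if ntapes = 0). *)
Record machine := Machine {
  ntapes : nat;
  state : finType;
  aux : finType;
  start : state;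
  halting : pred state;
  trans : state -> {ffun 'I_ntapes.+1 -> option (bool + aux)} ->
          state * ('I_ntapes.+1 -> option (bool + aux) * move)
}.

Section Machine.
Variable M : machine.

Definition symbol : Type := option (bool + aux M).

Record config := Config {
  cstate : state M;
  chead : 'I_(ntapes M).+1 -> nat;
  ctape : 'I_(ntapes M).+1 -> nat -> symbol
}.

Definition tape_of_word (w : seq bool) : nat -> symbol :=
  fun j => nth None (map (fun b => Some (inl b)) w) j.

Definition init_config (w : seq bool) : config :=
  Config (start M) (fun=> 0)
    (fun i => if i == ord0 then tape_of_word w else fun=> None).

(* Moving left from cell 0 leaves the head in place. *)
Definition move_head (d : move) (h : nat) : nat :=
  match d with MoveLeft => h.-1 | MoveStay => h | MoveRight => h.+1 end.

Definition step (c : config) : config :=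
  if halting (cstate c) then c else
  let: (s, act) := trans (cstate c) [ffun i => ctape c i (chead c i)] in
  Config s
    (fun i => move_head (act i).2 (chead c i))
    (fun i => update (ctape c i) (chead c i) (act i).1).

Definition computes_within (t : nat) (w v : seq bool) : Prop :=
  let c := iter t step (init_config w) in
  halting (cstate c) /\ forall j, ctape c ord_max j = tape_of_word v j.

End Machine.

(* Every polynomial in N is bounded by N ^ d + d for some d. *)
Definition poly_time (f : nat -> nat) : Prop :=
  exists (M : machine) (d : nat), forall n,
    computes_within M (size (bits n) ^ d + d) (bits n) (bits (f n)).

Definition poly_reducible (A B : set nat) : Prop :=
  exists2 f : nat -> nat, poly_time f & forall n, A n <-> B (f n).

Definition Sigma21_complete (B : set nat) : Prop :=
  Sigma21 B /\ forall A : set nat, Sigma21 A -> poly_reducible A B.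

(* Main.v *)
From Corelib Require Import PosDef.
From mathcomp Require Import all_boot boolp classical_sets zify.
Require Import Defs.

(** Membership: the third-order quantifiers guess the set T of traces and the set
    of all pairs (suffix of the prefix-notation sentence, environment) at which
    that suffix is closed and true. The propositions overridden so far and the
    traces bound so far form a set of numbers, so that one second-order clause
    certifies the guess; the truth of the quantifier-free part is certified by a
    single set of numbers.

    Hardness: the sentence forces T to consist of all assignments of sets of
    numbers to the variables of the arithmetical formula, which is possible since
    propositional quantifiers range over all sets of numbers, each labelled with
    the truth values of the subformulas. Truth values are then constrained by
    comparing two or three traces at a time, as in Tarski's definition; addition
    and multiplication are treated like subformulas, by their recursion equations.
    The input n enters only through its binary digits, which occur one after the
    other in the sentence, so that a finite transducer computes the reduction. *)

Set Implicit Arguments.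
Unset Strict Implicit.
Unset Printing Implicit Defensive.

(** * Finite transducers run in polynomial time *)

(** A trace carries a single assignment, while Tarski's clause for a quantifier refers to a variant
    assignment. This is why [T] must contain every assignment: a true instance of the body is then
    always visible as another trace of [T], which agrees with the first one off one track. On the
    membership side, no negation stands above a quantifier of a HyperQPTL sentence. The certificate
    therefore records true pairs only, and a one-way condition suffices: each recorded pair is
    justified by other recorded pairs. The quantifier-free part does contain negation, so its table
    records truth values instead. Justification always leads to smaller codes, hence strong
    induction on the code replaces any minimality condition on the guessed sets. *)

Lemma bits_double (b : bool) n : 0 < n -> bits (b + n.*2) = b :: bits n.
Proof.
move=> n0; rewrite /bits; case E: (bin_of_nat n) => [|p].
  by move: n0; rewrite -(bin_of_natK n) E.
have -> : b + n.*2 = nat_of_bin (Npos (if b then xI p else xO p)).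
  rewrite -(bin_of_natK n) E /=; case: b => /=; rewrite natTrecE; lia.
by rewrite nat_of_binK; case: b.
Qed.

Lemma bits_rec n : 0 < n -> bits n = odd n :: bits n./2.
Proof.
move=> n0; case: (posnP n./2) => [h0|h0].
  have -> : n = 1 by lia.
  by [].
by rewrite -{1}(odd_double_half n) bits_double.
Qed.

Lemma nat_of_word_gt0 w : 0 < nat_of_word w.
Proof. by elim: w => //= b w; rewrite -/(nat_of_word w); lia. Qed.

Lemma bits_nat_of_word w : bits (nat_of_word w) = rcons w true.
Proof.
by elim: w => //= b w <-; rewrite -/(nat_of_word w) bits_double ?nat_of_word_gt0.
Qed.

Section Transducer.
Variables (pre suf : seq bool) (W : bool -> seq bool).

(** The tag [(true, true)] stands for the phase writing the prefix, [(false, b)] for the one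
    answering an input letter [b], [(true, false)] for the final one. *)
Definition phase_word (tag : bool * bool) : seq bool :=
  let: (ends, b) := tag in
  if ends then (if b then pre else suf) else W b.

Definition phase_bound : nat :=
  size pre + size suf + size (W true) + size (W false).

Lemma size_phase_word tag : size (phase_word tag) <= phase_bound.
Proof. by case: tag => -[] [] /=; rewrite /phase_bound; lia. Qed.

(* A state (tag, p) has already written the first p letters of
   [phase_word tag]. *)
Definition transducer : machine :=
  @Machine 1 ((bool * bool) * 'I_phase_bound.+1)%type void
    ((true, true), ord0)
    (fun s => (s.1 == (true, false)) && (s.2 == size suf :> nat))
    (fun s r =>
       let: (tag, p) := s in
       if p < size (phase_word tag) then
         ((tag, inord p.+1), fun i =>
            if i == ord_max
            then (Some (inl (nth false (phase_word tag) p)), MoveRight)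
            else (r i, MoveStay))
       else if r ord0 is Some (inl b) then
         (((false, b), ord0),
          fun i => (r i, if i == ord0 then MoveRight else MoveStay))
       else (((true, false), ord0), fun i => (r i, MoveStay))).

Definition transducer_at (c : config transducer) tag p h x v : Prop :=
  [/\ cstate c = (tag, inord p), chead c ord0 = h, chead c ord_max = size v,
      ctape c ord0 =1 tape_of_word transducer x &
      ctape c ord_max =1 tape_of_word transducer v].

Lemma update_tape_same (M : machine) (tp : nat -> symbol M) h :
  update tp h (tp h) =1 tp.
Proof. by move=> j; rewrite /update; case: eqP => [->|]. Qed.

Lemma update_tape_rcons (M : machine) v b :
  update (tape_of_word M v) (size v) (Some (inl b)) =1
  tape_of_word M (rcons v b).
Proof.
move=> j; rewrite /update /tape_of_word map_rcons nth_rcons size_map.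
by case: (ltngtP j (size v)) => // h; rewrite nth_default // size_map ltnW.
Qed.

Lemma transducer_write c tag p h x v :
  transducer_at c tag p h x v -> p < size (phase_word tag) ->
  transducer_at (step c) tag p.+1 h x
    (rcons v (nth false (phase_word tag) p)).
Proof.
move=> [cs ch0 ch1 ct0 ct1] lt_p.
have le_p := leq_trans lt_p (size_phase_word tag).
rewrite /step cs /= inordK; last lia.
have -> : (tag == (true, false)) && (p == size suf) = false.
  by apply/negP => /andP[/eqP tE /eqP pE]; move: lt_p; rewrite tE pE /= ltnn.
rewrite lt_p; split => //=.
- by rewrite ch1 size_rcons.
- by move=> j; rewrite ffunE update_tape_same ct0.
- move=> j; rewrite -update_tape_rcons /update ch1.
  by case: eqP => // _; rewrite ct1.
Qed.

Lemma transducer_write_all c tag h x v :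
  transducer_at c tag 0 h x v ->
  transducer_at (iter (size (phase_word tag)) (@step transducer) c) tag
    (size (phase_word tag)) h x (v ++ phase_word tag).
Proof.
move=> cT.
suff H p : p <= size (phase_word tag) ->
    transducer_at (iter p (@step transducer) c) tag p h x
      (v ++ take p (phase_word tag)).
  by have := H _ (leqnn _); rewrite take_size.
elim: p => [|p IHp] lt_p; first by rewrite take0 cats0.
rewrite (take_nth false) // -rcons_cat.
exact: transducer_write (IHp (ltnW lt_p)) lt_p.
Qed.

Lemma transducer_read c tag h x v :
  tag != (true, false) ->
  transducer_at c tag (size (phase_word tag)) h x v ->
  if h < size x
  then transducer_at (step c) (false, nth false x h) 0 h.+1 x v
  else transducer_at (step c) (true, false) 0 h x v.
Proof.
move=> tagN [cs ch0 ch1 ct0 ct1].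
have le_p := size_phase_word tag.
rewrite /step cs /= inordK // (negbTE tagN) /= ltnn ffunE ct0 ch0 /tape_of_word.
have inord0 : inord 0 = ord0 :> 'I_phase_bound.+1.
  by apply: val_inj; rewrite /= inordK.
case: ltnP => hx.
  rewrite (nth_map false) //; split => //=.
  - by rewrite inord0.
  - by rewrite ch0.
  - by move=> j; rewrite ffunE update_tape_same ct0.
  - by move=> j; rewrite ffunE update_tape_same ct1.
rewrite nth_default ?size_map //; split => //=.
- by rewrite inord0.
- by move=> j; rewrite ffunE update_tape_same ct0.
- by move=> j; rewrite ffunE update_tape_same ct1.
Qed.

Lemma transducer_halt c h x v :
  transducer_at c (true, false) (size suf) h x v -> halting (cstate c).
Proof.
move=> [-> _ _ _ _] /=; rewrite inordK ?eqxx //.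
exact: (size_phase_word (true, false)).
Qed.

(** Lets a run that halts early meet a demand for an exact number of steps. *)
Lemma iter_step_halting (M : machine) t (c : config M) :
  halting (cstate c) -> iter t (@step M) c = c.
Proof. by move=> hc; elim: t => //= t ->; rewrite /step hc. Qed.

(** Each remaining letter costs one reading step and at most [phase_bound] writing steps; one
    further round meets the blank and writes [suf]. *)
Lemma transducer_loop c tag h x v :
  tag != (true, false) -> h <= size x ->
  transducer_at c tag (size (phase_word tag)) h x v ->
  exists t h', t <= (size x - h).+1 * phase_bound.+1 /\
    transducer_at (iter t (@step transducer) c) (true, false) (size suf) h' x
      (v ++ flatten (map W (drop h x)) ++ suf).
Proof.
move kE: (size x - h) => k.
elim: k h kE c tag v => [|k IHk] h kE c tag v tagN hx cT.
all: have := transducer_read tagN cT.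
  rewrite ltnNge -subn_eq0 kE eqxx /= => cT1.
  have := transducer_write_all cT1; rewrite -iterSr => cT2.
  exists (size suf).+1, h; split.
    by have := size_phase_word (true, false); rewrite /=; lia.
  by rewrite drop_oversize ?cats0 //; lia.
have lt_hx : h < size x by lia.
rewrite lt_hx => cT1.
have := transducer_write_all cT1; rewrite -iterSr => cT2.
have kE' : size x - h.+1 = k by lia.
have [t [h' [le_t cT3]]] := IHk h.+1 kE' _ (false, _) _ isT lt_hx cT2.
exists (t + (size (W (nth false x h))).+1), h'; split.
  have := size_phase_word (false, nth false x h); rewrite /=; nia.
by move: cT3; rewrite iterD [in X in _ -> X](drop_nth false) //= -!catA.
Qed.

Lemma transducer_computes x :
  computes_within transducer ((size x).+2 * phase_bound.+1) x
    (pre ++ flatten (map W x) ++ suf).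
Proof.
have cT0 : transducer_at (init_config transducer x) (true, true) 0 0 x [::].
  split => //=.
  - by congr pair; apply: val_inj; rewrite /= inordK.
  - by move=> j; rewrite /tape_of_word nth_nil.
have cT1 := transducer_write_all cT0.
have [//|//|t [h [le_t cT2]]] := transducer_loop _ _ cT1.
rewrite /= drop0 in cT2.
have hc := transducer_halt cT2.
have le_pre := size_phase_word (true, true); rewrite /= in le_pre.
rewrite /computes_within.
have -> : (size x).+2 * phase_bound.+1 =
    ((size x).+2 * phase_bound.+1 - (t + size pre)) + (t + size pre) by nia.
rewrite !iterD iter_step_halting //; split => //.
by case: cT2.
Qed.

End Transducer.

Lemma poly_time_transducer (f : nat -> nat) pre suf W :
  (forall n, bits (f n) = pre ++ flatten (map W (bits n)) ++ suf) ->
  poly_time f.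
Proof.
move=> fE; exists (transducer pre suf W).
(* One number serves as exponent and as summand. For inputs of size 0 or 1 the power is too small
   and the summand must cover up to three rounds; from size 2 on the power absorbs the multiple of
   the size. *)
pose C := 3 * (phase_bound pre suf W).+1; exists C => n.
have [hlt tpE] := transducer_computes pre suf W (bits n).
have le_t : (size (bits n)).+2 * (phase_bound pre suf W).+1 <=
    size (bits n) ^ C + C.
  rewrite /C; move: (size _) (phase_bound _ _ _) => N B.
  have [->|[->|N2]] : N = 0 \/ N = 1 \/ 2 <= N by lia.
  - lia.
  - rewrite exp1n; lia.
  - have : N * 2 ^ (3 * B.+1).-1 <= N ^ (3 * B.+1).
      case E: (3 * B.+1) => [|k]; first lia.
      by rewrite expnS leq_mul2l leq_exp2r ?N2 ?orbT //; lia.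
    have : B.+1 < 2 ^ B.+1 by apply: ltn_expl.
    have : 2 ^ B.+1 <= 2 ^ (3 * B.+1).-1 by rewrite leq_exp2l //; lia.
    nia.
rewrite /computes_within -(subnK le_t) iterD iter_step_halting // fE.
by split.
Qed.

(** * Unique readability of the codes *)

Definition seq_code (s : seq nat) : nat := nat_of_word (flatten (map unary s)).

Lemma nat_of_word_inj : injective nat_of_word.
Proof.
move=> v w E; have : rcons v true = rcons w true by rewrite -!bits_nat_of_word E.
by move/rcons_inj => [].
Qed.

(** The words [unary a] are nonempty and form a prefix code, so a concatenation splits in one way
    only. *)
Lemma flatten_unary_inj : injective (fun s => flatten (map unary s)).
Proof.
have unary_cat a b u v : unary a ++ u = unary b ++ v -> a = b /\ u = v.
  rewrite /unary !cat_rcons; elim: a b => [|a IH] [|b] //= [].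
    by move=> ->.
  by move=> /IH [-> ->].
elim=> [|a s IH] [|b s'] //=; rewrite /unary.
- by case: b.
- by case: a.
by move=> /unary_cat [-> /IH ->].
Qed.

Lemma seq_code_inj : injective seq_code.
Proof. by move=> s s' /nat_of_word_inj /flatten_unary_inj. Qed.

(** A leading digit [true] turns the code n into 2n + 1, that is, doubles n + 1. Prepending a number
    is thus arithmetical once the graph of powers of two is available; [push_code] relies on
    this. *)
Lemma seq_code_cons a s : (seq_code (a :: s)).+1 = 2 ^ a * (seq_code s).*2.+1.
Proof.
rewrite /seq_code /= /unary cat_rcons.
elim: a => [|a IH]; first by rewrite expn0 mul1n.
rewrite expnS -mulnA -IH /= -/(nat_of_word _); lia.
Qed.

Lemma seq_code_cons_lt a s : seq_code s < seq_code (a :: s).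
Proof.
have E := seq_code_cons a s; have H : 0 < 2 ^ a by rewrite expn_gt0.
have H1 : 0 < seq_code s by apply: nat_of_word_gt0.
by nia.
Qed.

Lemma seq_code_cat_le l s : seq_code s <= seq_code (l ++ s).
Proof.
by elim: l => //= a l IH; apply: leq_trans IH _; apply/ltnW/seq_code_cons_lt.
Qed.

(** The continuations are there for the induction: the left operand of a disjunction is followed by
    the right one. *)
Lemma qfree_polish_inj m (psi psi' : qfree 'I_m.+1) s s' :
  qfree_polish psi ++ s = qfree_polish psi' ++ s' -> psi = psi' /\ s = s'.
Proof.
elim: psi psi' s s' => [p v|q|psi IH|psi1 IH1 psi2 IH2|psi IH|psi IH]
  [p' v'|q'|psi'|psi1' psi2'|psi'|psi'] s s' //=.
- by case=> /val_inj -> -> ->.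
- by case=> /val_inj -> ->.
- by case=> /IH [-> ->].
- by case; rewrite -!catA => /IH1 [-> /IH2 [-> ->]].
- by case=> /IH [-> ->].
- by case=> /IH [-> ->].
Qed.

Lemma hyperqptl_polish_inj m : injective (@hyperqptl_polish m).
Proof.
elim=> [v phi IH|v phi IH|q phi IH|q phi IH|psi]
  [v' phi'|v' phi'|q' phi'|q' phi'|psi'] //=; try by [case: psi | case: psi'].
- by case=> -> /IH ->.
- by case=> -> /IH ->.
- by case=> /val_inj -> /IH ->.
- by case=> /val_inj -> /IH ->.
- move=> E.
  by have [|-> _] := @qfree_polish_inj _ psi psi' [::] [::]; rewrite ?cats0.
Qed.

Lemma hyperqptl_code_inj m m' (phi : hyperqptl 'I_m.+1)
    (phi' : hyperqptl 'I_m'.+1) :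
  hyperqptl_code phi = hyperqptl_code phi' ->
  Tagged (fun k => hyperqptl 'I_k.+1) phi =
  Tagged (fun k => hyperqptl 'I_k.+1) phi'.
Proof.
move=> /seq_code_inj [mE]; case: m' / mE phi' => phi' /hyperqptl_polish_inj ->.
by [].
Qed.

(** * Arithmetical formulas *)

Local Open Scope classical_set_scope.

Section Connectives.
Variable k : nat.

Definition AAnd (p q : arith k) := ANeg (AOr (ANeg p) (ANeg q)).
Definition AImp (p q : arith k) := AOr (ANeg p) q.

Section Sat.
Variables (e1 : nat -> nat) (e2 : nat -> set nat) (Y : 'I_k -> set (set nat)).

Lemma sat_AAnd p q P Q : (arith_sat e1 e2 Y p <-> P) ->
  (arith_sat e1 e2 Y q <-> Q) -> arith_sat e1 e2 Y (AAnd p q) <-> P /\ Q.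
Proof. by move=> <- <-; rewrite /= not_orE !notK. Qed.

Lemma sat_AImp p q (P Q : Prop) : (arith_sat e1 e2 Y p <-> P) ->
  (arith_sat e1 e2 Y q <-> Q) -> arith_sat e1 e2 Y (AImp p q) <-> (P -> Q).
Proof. by move=> <- <-; rewrite /= implyE. Qed.

Lemma sat_AOr p q P Q : (arith_sat e1 e2 Y p <-> P) ->
  (arith_sat e1 e2 Y q <-> Q) -> arith_sat e1 e2 Y (AOr p q) <-> P \/ Q.
Proof. by move=> <- <-. Qed.

Lemma sat_ANeg p P : (arith_sat e1 e2 Y p <-> P) ->
  arith_sat e1 e2 Y (ANeg p) <-> ~ P.
Proof. by move=> <-. Qed.

Lemma sat_AEx1 x p (P : nat -> Prop) :
  (forall a, arith_sat (update e1 x a) e2 Y p <-> P a) ->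
  arith_sat e1 e2 Y (AEx1 x p) <-> exists a, P a.
Proof. by move=> H; split=> -[a /H Ha]; exists a. Qed.

Lemma sat_AAll1 x p (P : nat -> Prop) :
  (forall a, arith_sat (update e1 x a) e2 Y p <-> P a) ->
  arith_sat e1 e2 Y (AAll1 x p) <-> forall a, P a.
Proof. by move=> H; split=> Ha a; apply/H. Qed.

Lemma sat_AEx2 X p (P : set nat -> Prop) :
  (forall A, arith_sat e1 (update e2 X A) Y p <-> P A) ->
  arith_sat e1 e2 Y (AEx2 X p) <-> exists A, P A.
Proof. by move=> H; split=> -[a /H Ha]; exists a. Qed.

Lemma sat_AAll2 X p (P : set nat -> Prop) :
  (forall A, arith_sat e1 (update e2 X A) Y p <-> P A) ->
  arith_sat e1 e2 Y (AAll2 X p) <-> forall A, P A.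
Proof. by move=> H; split=> Ha a; apply/H. Qed.

End Sat.
End Connectives.

(** Atoms are closed by conversion, so the intended meaning of a formula has to be written with the
    same nesting of connectives as the formula. *)
Ltac sat_step :=
  lazymatch goal with
  | |- arith_sat _ _ _ (AAnd _ _) <-> _ => apply: sat_AAnd
  | |- arith_sat _ _ _ (AImp _ _) <-> _ => apply: sat_AImp
  | |- arith_sat _ _ _ (AOr _ _) <-> _ => apply: sat_AOr
  | |- arith_sat _ _ _ (ANeg _) <-> _ => apply: sat_ANeg
  | |- arith_sat _ _ _ (AEx1 _ _) <-> _ => apply: sat_AEx1 => ?
  | |- arith_sat _ _ _ (AAll1 _ _) <-> _ => apply: sat_AAll1 => ?
  | |- arith_sat _ _ _ (AEx2 _ _) <-> _ => apply: sat_AEx2 => ?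
  | |- arith_sat _ _ _ (AAll2 _ _) <-> _ => apply: sat_AAll2 => ?
  | |- arith_sat _ _ _ _ <-> _ => exact: iff_refl
  end.

Lemma update_same (A : Type) (f : nat -> A) x a : update f x a x = a.
Proof. by rewrite /update eqxx. Qed.

Lemma update_other (A : Type) (f : nat -> A) x a y :
  y != x -> update f x a y = f y.
Proof. by rewrite /update => /negbTE ->. Qed.

Lemma term_eval_closed xs t e1 e1' : term_closed xs t ->
  {in xs, e1 =1 e1'} -> term_eval e1 t = term_eval e1' t.
Proof.
move=> + H; elim: t => [x|t1 IH1 t2 IH2|t1 IH1 t2 IH2] /=; first exact: H.
all: by move=> /andP[/IH1 -> /IH2 ->].
Qed.

Lemma update_in (A : Type) (f f' : nat -> A) xs x a :
  {in xs, f =1 f'} -> {in x :: xs, update f x a =1 update f' x a}.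
Proof.
move=> ff' y; rewrite inE /update; case: eqP => //= _; exact: ff'.
Qed.

Lemma arith_sat_closed k (psi : arith k) xs Xs e1 e1' e2 e2' Y :
  arith_closed xs Xs psi -> {in xs, e1 =1 e1'} -> {in Xs, e2 =1 e2'} ->
  arith_sat e1 e2 Y psi <-> arith_sat e1' e2' Y psi.
Proof.
elim: psi xs Xs e1 e1' e2 e2' => /=.
1,2: by move=> t1 t2 xs Xs e1 e1' e2 e2' /andP[c1 c2] H1 H2;
  rewrite (term_eval_closed c1 H1) (term_eval_closed c2 H1).
- move=> t X xs Xs e1 e1' e2 e2' /andP[c1 c2] H1 H2.
  by rewrite (term_eval_closed c1 H1) H2.
- by move=> X j xs Xs e1 e1' e2 e2' cX H1 H2; rewrite H2.
- by move=> p IH xs Xs e1 e1' e2 e2' cp H1 H2; rewrite (IH _ _ _ _ _ _ cp H1 H2).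
- move=> p IHp q IHq xs Xs e1 e1' e2 e2' /andP[cp cq] H1 H2.
  by rewrite (IHp _ _ _ _ _ _ cp H1 H2) (IHq _ _ _ _ _ _ cq H1 H2).
- move=> x p IH xs Xs e1 e1' e2 e2' cp H1 H2; split=> -[a Ha]; exists a; move: Ha;
  by rewrite (IH _ _ _ _ _ _ cp (update_in a H1) H2).
- move=> x p IH xs Xs e1 e1' e2 e2' cp H1 H2; split=> Ha a; move: (Ha a);
  by rewrite (IH _ _ _ _ _ _ cp (update_in a H1) H2).
- move=> x p IH xs Xs e1 e1' e2 e2' cp H1 H2; split=> -[a Ha]; exists a; move: Ha;
  by rewrite (IH _ _ _ _ _ _ cp H1 (update_in a H2)).
- move=> x p IH xs Xs e1 e1' e2 e2' cp H1 H2; split=> Ha a; move: (Ha a);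
  by rewrite (IH _ _ _ _ _ _ cp H1 (update_in a H2)).
Qed.

Definition pair_nat (x y : nat) : nat := (x + y) * (x + y) + x.

(** With s = x + y the value lies between s^2 and s^2 + s, below (s + 1)^2; it determines s and then
    x. Unlike pairings with a division by two, this one is a term of the language. *)
Lemma pair_nat_inj x y x' y' :
  pair_nat x y = pair_nat x' y' -> x = x' /\ y = y'.
Proof.
rewrite /pair_nat => H.
have E : x + y = x' + y' by case: (ltngtP (x + y) (x' + y')) => //; nia.
by rewrite E in H; lia.
Qed.

Definition TPair (s t : term) : term :=
  TAdd (TMul (TAdd s t) (TAdd s t)) s.

Lemma nth_bits n i : nth false (bits n) i = odd (n %/ 2 ^ i).
Proof.
elim: i n => [|i IHi] n; case: (posnP n) => [->|n0]; rewrite ?div0n ?nth_nil //.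
  by rewrite bits_rec //= divn1.
by rewrite bits_rec //= IHi -divn2 -divnMA -expnS.
Qed.

Definition bitset (n : nat) : set nat := [set i | nth false (bits n) i].

Lemma bitsetE n i : bitset n i = odd (n %/ 2 ^ i).
Proof. by rewrite /bitset /= nth_bits. Qed.

(* Says that the set variable 0 holds the positions of the digits 1 of the
   number variable 0: the set variable 1 contains the pairs (i, n / 2 ^ i). *)
Definition bits_formula k : arith k :=
  let n := TVar 0 in let z := TVar 1 in let u := TVar 2 in
  let i := TVar 3 in let v := TVar 4 in let w := TVar 5 in
  AEx1 1 (AEx1 2 (AEx2 1 (AAnd (AEq _ (TAdd z z) z)
   (AAnd (AAnd (AEq _ (TMul u u) u) (ALt _ z u))
   (AAnd (AIn2 _ (TPair z n) 1)
    (AAll1 3 (AAll1 4 (AImp (AIn2 _ (TPair i v) 1)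
      (AEx1 5 (AAnd (AIn2 _ (TPair (TAdd i u) w) 1)
        (AOr (AAnd (AIn2 _ i 0) (AEq _ v (TAdd (TAdd w w) u)))
             (AAnd (ANeg (AIn2 _ i 0)) (AEq _ v (TAdd w w)))))))))))))).

(** The language has no constants; z + z = z forces 0, and u * u = u with z < u forces 1. The set of
    pairs is only required to be closed under the step, but halving is functional, so starting from
    (0, n) it must contain every (i, n / 2 ^ i). *)
Lemma sat_bits_formula k e1 e2 Y :
  arith_sat e1 e2 Y (bits_formula k) <-> e2 0 = bitset (e1 0).
Proof.
have -> : arith_sat e1 e2 Y (bits_formula k) <->
  exists z u G, z + z = z /\ (u * u = u /\ z < u) /\ G (pair_nat z (e1 0)) /\
    forall i v, G (pair_nat i v) -> exists w, G (pair_nat (i + u) w) /\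
      (e2 0 i /\ v = w + w + u \/ ~ e2 0 i /\ v = w + w).
  by rewrite /bits_formula; repeat sat_step.
split.
  move=> [z [u [G [zE [[uE uz] [G0 GS]]]]]].
  have z0 : z = 0 by lia.
  have u1 : u = 1 by nia.
  rewrite {}z0 {}u1 in zE uE uz G0 GS.
  have step i v : G (pair_nat i v) -> G (pair_nat i.+1 v./2) /\ (e2 0 i <-> odd v).
    move=> /(GS i v) [w]; rewrite addn1 => -[Gw [] [ei vE]].
      have -> : v./2 = w by lia.
      by split=> //; split=> // _; lia.
    have -> : v./2 = w by lia.
    by split=> //; split=> // o; lia.
  have Gi i : G (pair_nat i (e1 0 %/ 2 ^ i)).
    elim: i => [|i IHi]; first by rewrite divn1.
    by have [+ _] := step _ _ IHi; rewrite -divn2 -divnMA -expnSr.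
  apply/seteqP; split => i; rewrite bitsetE.
    by move=> ei; apply/(step _ _ (Gi i)).2.
  by move=> /(step _ _ (Gi i)).2.
move=> eE; exists 0, 1, [set x | exists i, x = pair_nat i (e1 0 %/ 2 ^ i)].
do 3!split=> //; first by exists 0; rewrite divn1.
move=> i v [j] /pair_nat_inj [<- vE]; exists (v./2); split.
  by exists i.+1; rewrite addn1 vE -divn2 -divnMA -expnSr.
have eiE : e2 0 i = odd v by rewrite eE bitsetE vE.
rewrite eiE; case: (boolP (odd v)) => ov; [left|right]; split=> //; lia.
Qed.

(** * Elimination of terms *)

(* All variables range over sets of numbers; those with an even index range
   over singletons and stand for first-order variables. The arguments of RAdd
   and RMul are first-order variables, so that x is the variable 2x. *)
Inductive rform (K : nat) : Type :=
| RAdd of nat & nat & nat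
| RMul of nat & nat & nat
| RLt of nat & nat
| REq of nat & nat
| RIn of nat & nat
| RIn3 of nat & 'I_K
| RNeg of rform K
| ROr of rform K & rform K
| REx of nat & rform K.

Lemma singleton_inj (a b : nat) : [set a] = [set b] :> set nat -> a = b.
Proof. by move/seteqP => [H _]; apply: H. Qed.

Definition is_single (A : set nat) : Prop := exists a, A = [set a].

Definition graph2 (op : nat -> nat -> nat) (A B C : set nat) : Prop :=
  exists a b, [/\ A = [set a], B = [set b] & C = [set op a b]].

Section Relational.
Variable K : nat.
Implicit Types (r : rform K) (rho : nat -> set nat).

Definition RAnd r1 r2 : rform K := RNeg (ROr (RNeg r1) (RNeg r2)).

Fixpoint rsat (Y : 'I_K -> set (set nat)) rho r : Prop :=
  match r with
  | RAdd i j l => graph2 addn (rho i.*2) (rho j.*2) (rho l.*2)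
  | RMul i j l => graph2 muln (rho i.*2) (rho j.*2) (rho l.*2)
  | RLt i j => exists a b, [/\ rho i a, rho j b & a < b]
  | REq i j => rho i = rho j
  | RIn i j => exists a, rho i a /\ rho j a
  | RIn3 i j => Y j (rho i)
  | RNeg r1 => ~ rsat Y rho r1
  | ROr r1 r2 => rsat Y rho r1 \/ rsat Y rho r2
  | REx i r1 => exists A, (~~ odd i -> is_single A) /\ rsat Y (update rho i A) r1
  end.

Lemma rsat_RAnd Y rho r1 r2 :
  rsat Y rho (RAnd r1 r2) <-> rsat Y rho r1 /\ rsat Y rho r2.
Proof. by rewrite /= not_orE !notK. Qed.

Lemma rsat_REx Y rho i r : rsat Y rho (REx i r) <->
  exists A, (~~ odd i -> is_single A) /\ rsat Y (update rho i A) r.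
Proof. by []. Qed.

Fixpoint term_bound (t : term) : nat :=
  match t with
  | TVar x => x.+1
  | TAdd t1 t2 | TMul t1 t2 => maxn (term_bound t1) (term_bound t2)
  end.

Lemma term_eval_bound t k e1 e1' : term_bound t <= k ->
  (forall x, x < k -> e1 x = e1' x) -> term_eval e1 t = term_eval e1' t.
Proof.
move=> + H; elim: t => [x|t1 IH1 t2 IH2|t1 IH1 t2 IH2] /=; first exact: H.
all: by rewrite geq_max => /andP[/IH1 -> /IH2 ->].
Qed.

Definition rbind k r1 r2 r3 : rform K :=
  REx k.*2 (REx k.+1.*2 (RAnd r1 (RAnd r2 r3))).

(* [rterm t z k] says that the first-order variable z has the value of t; the
   auxiliary first-order variables are numbered from k on. *)
Fixpoint rterm (t : term) (z k : nat) : rform K :=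
  match t with
  | TVar x => REq _ x.*2 z.*2
  | TAdd t1 t2 => rbind k (rterm t1 k k.+2) (rterm t2 k.+1 k.+2)
                    (RAdd _ k k.+1 z)
  | TMul t1 t2 => rbind k (rterm t1 k k.+2) (rterm t2 k.+1 k.+2)
                    (RMul _ k k.+1 z)
  end.

Definition fo_agree k rho (e1 : nat -> nat) : Prop :=
  forall x, x < k -> rho x.*2 = [set e1 x].

Definition rterm_correct Y t : Prop := forall z k rho e1,
  term_bound t <= k -> fo_agree k rho e1 -> z < k ->
  rsat Y rho (rterm t z k) <-> rho z.*2 = [set term_eval e1 t].

(** The two bound variables are forced to the singletons of the values of the terms, so the
    quantifiers collapse to an update. The subterms draw their auxiliary names from [k.+2] on and do
    not capture [k] and [k.+1]. *)
Lemma rsat_rbind Y t1 t2 r k rho e1 :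
  rterm_correct Y t1 -> rterm_correct Y t2 ->
  maxn (term_bound t1) (term_bound t2) <= k -> fo_agree k rho e1 ->
  rsat Y rho (rbind k (rterm t1 k k.+2) (rterm t2 k.+1 k.+2) r) <->
  rsat Y (update (update rho k.*2 [set term_eval e1 t1])
                 k.+1.*2 [set term_eval e1 t2]) r.
Proof.
move=> IH1 IH2; rewrite geq_max => /andP[le1 le2] fo.
have H a b (r12 := update (update rho k.*2 [set a]) k.+1.*2 [set b]) :
    (rsat Y r12 (rterm t1 k k.+2) <-> a = term_eval e1 t1) /\
    (rsat Y r12 (rterm t2 k.+1 k.+2) <-> b = term_eval e1 t2).
  pose e1' := update (update e1 k a) k.+1 b.
  have fo' : fo_agree k.+2 r12 e1'.
    move=> x lex; rewrite /r12 /e1' /update.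
    case: (eqVneq x k.+1) => [->|nx]; first by rewrite eqxx.
    have -> : (x.*2 == k.+1.*2) = false by lia.
    case: (eqVneq x k) => [->|nx']; first by rewrite eqxx.
    have -> : (x.*2 == k.*2) = false by lia.
    by apply: fo; lia.
  have e1E x : x < k -> e1' x = e1 x.
    by move=> ltx; rewrite /e1' !update_other //; lia.
  rewrite (IH1 _ _ _ e1') ?(IH2 _ _ _ e1'); try lia; try exact: fo'.
  rewrite (term_eval_bound le1 e1E) (term_eval_bound le2 e1E).
  rewrite /r12 update_same update_other ?update_same; last lia.
  by split; split=> [/singleton_inj|->].
split.
  move=> /rsat_REx [A [sA /rsat_REx [B [sB /rsat_RAnd [Ha /rsat_RAnd [Hb Hr]]]]]].
  have [|a Aa] := sA; first by rewrite odd_double.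
  have [|b Bb] := sB; first by rewrite odd_double.
  rewrite {}Aa {}Bb {A B sA sB} in Ha Hb Hr.
  by rewrite -((H a b).1.1 Ha) -((H a b).2.1 Hb).
move=> Hr; apply/rsat_REx; exists [set term_eval e1 t1]; split; first by eexists.
apply/rsat_REx; exists [set term_eval e1 t2]; split; first by eexists.
apply/rsat_RAnd; split; first exact/(H _ _).1.
by apply/rsat_RAnd; split; first exact/(H _ _).2.
Qed.

Lemma graph2_set1 op a b C :
  graph2 op [set a] [set b] C <-> C = [set op a b].
Proof.
split; last by move=> ->; exists a, b.
by move=> [a' [b' [/singleton_inj <- /singleton_inj <-]]].
Qed.

Lemma rsat_rterm Y t : rterm_correct Y t.
Proof.
elim: t => [x|t1 IH1 t2 IH2|t1 IH1 t2 IH2] z k rho e1.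
- by move=> ltx fo _; rewrite /= fo //; split=> ->.
all: move=> le fo ltz; apply: iff_trans (rsat_rbind _ IH1 IH2 le fo) _ => /=.
all: rewrite update_same update_other ?update_same; last by lia.
all: by rewrite graph2_set1 !update_other //; lia.
Qed.

(** Membership has a single term; passing it twice lets [rsat_rbind] serve all three kinds of
    atoms. *)
Definition ratom t1 t2 (r : nat -> rform K) : rform K :=
  let k := maxn (term_bound t1) (term_bound t2) in
  rbind k (rterm t1 k k.+2) (rterm t2 k.+1 k.+2) (r k).

Fixpoint rform_of_arith (psi : arith K) : rform K :=
  match psi with
  | AEq t1 t2 => ratom t1 t2 (fun k => REq _ k.*2 k.+1.*2)
  | ALt t1 t2 => ratom t1 t2 (fun k => RLt _ k.*2 k.+1.*2)
  | AIn2 t X => ratom t t (fun k => RIn _ k.*2 X.*2.+1)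
  | AIn3 X j => RIn3 X.*2.+1 j
  | ANeg p => RNeg (rform_of_arith p)
  | AOr p q => ROr (rform_of_arith p) (rform_of_arith q)
  | AEx1 x p => REx x.*2 (rform_of_arith p)
  | AAll1 x p => RNeg (REx x.*2 (RNeg (rform_of_arith p)))
  | AEx2 X p => REx X.*2.+1 (rform_of_arith p)
  | AAll2 X p => RNeg (REx X.*2.+1 (RNeg (rform_of_arith p)))
  end.

Lemma update_double (A : Type) (f : nat -> A) x a y :
  update f x.*2 a y.*2 = update (fun z => f z.*2) x a y.
Proof.
by rewrite /update; case: (eqVneq y x) => [->|n]; rewrite ?eqxx // ifN //; lia.
Qed.

Lemma update_doubleS (A : Type) (f : nat -> A) x a y :
  update f x.*2.+1 a y.*2.+1 = update (fun z => f z.*2.+1) x a y.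
Proof.
by rewrite /update; case: (eqVneq y x) => [->|n]; rewrite ?eqxx // ifN //; lia.
Qed.

Lemma rsat_rform_of_arith Y psi rho e1 e2 :
  (forall x, rho x.*2 = [set e1 x]) -> (forall X, rho X.*2.+1 = e2 X) ->
  rsat Y rho (rform_of_arith psi) <-> arith_sat e1 e2 Y psi.
Proof.
have so_ne x k : x.*2.+1 != k.*2 by lia.
have fo_ne x k : x.*2 != k.*2.+1 by lia.
have ex1 x (P Q : _ -> Prop) : (forall a : nat, P [set a] <-> Q a) ->
    (exists A, (~~ odd x.*2 -> is_single A) /\ P A) <-> exists a, Q a.
  move=> H; split=> [[A [sA PA]]|[a /H Pa]].
    have [|a Aa] := sA; first by rewrite odd_double.
    by exists a; apply/H; rewrite -Aa.
  by exists [set a]; split=> //; exists a.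
have ex2 X (P Q : _ -> Prop) : (forall A, P A <-> Q A) ->
    (exists A, (~~ odd X.*2.+1 -> is_single A) /\ P A) <-> exists A, Q A.
  move=> H; split=> [[A [_ /H QA]]|[A /H PA]]; exists A => //; split => //.
  by rewrite /= odd_double.
elim: psi rho e1 e2 => [t1 t2|t1 t2|t X|X j|p IH|p IHp q IHq|x p IH|x p IH|X p IH|
  X p IH] rho e1 e2 fo so.
1,2,3: have fo' k : fo_agree k rho e1 by [].
1,2,3: apply: iff_trans
  (rsat_rbind _ (@rsat_rterm Y _) (@rsat_rterm Y _) (leqnn _) (fo' _)) _.
all: rewrite /=.
1,2,3: rewrite ?[update _ _ _ _.+1.*2]update_same update_other ?update_same; try lia.
- by split=> [/singleton_inj|->].
- by split=> [[a [b [-> ->]]]|lt] //; do 2!eexists; split.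
- rewrite !update_other // so.
  by split=> [[a [-> ]]|lt] //; eexists; split.
- by rewrite so.
- by rewrite (IH rho e1 e2).
- by rewrite (IHp rho e1 e2) // (IHq rho e1 e2).
- apply: ex1 => a; apply: IH => y; first by rewrite update_double /update; case: eqP.
  by rewrite update_other.
- rewrite (ex1 _ _ (fun a => ~ arith_sat (update e1 x a) e2 Y p)).
    by split=> [/forallNP H a|H [a]]; [apply: contrapT; apply: H|apply].
  move=> a; rewrite (IH _ (update e1 x a) e2) // => y.
    by rewrite update_double /update; case: eqP.
  by rewrite update_other.
- apply: ex2 => a; apply: IH => y; first by rewrite update_other.
  by rewrite update_doubleS /update; case: eqP.
- rewrite (ex2 _ _ (fun a => ~ arith_sat e1 (update e2 X a) Y p)).
    by split=> [/forallNP H a|H [a]]; [apply: contrapT; apply: H|apply].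
  move=> a; rewrite (IH _ e1 (update e2 X a)) // => y.
    by rewrite update_other.
  by rewrite update_doubleS /update; case: eqP.
Qed.

End Relational.

(** * Prenex HyperQPTL sentences *)

Section Prenex.
Variable AP : finType.
Implicit Types (T : set (trace AP)) (psi : qfree AP) (phi : hyperqptl AP).
Implicit Types (tt : nat -> trace AP) (F : AP -> nat -> bool).

Fixpoint ev F tt (i : nat) psi : Prop :=
  match psi with
  | QLab p v => p \in tt v i
  | QProp q => F q i
  | QNeg psi1 => ~ ev F tt i psi1
  | QOr psi1 psi2 => ev F tt i psi1 \/ ev F tt i psi2
  | QNext psi1 => ev F tt i.+1 psi1
  | QEventually psi1 => exists2 j, i <= j & ev F tt j psi1
  end.

(** Keeps the two vocabularies apart: quantifying the propositions of [qs] leaves all labelled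
    propositions of the traces as they are. *)
Fixpoint separated (qs : seq AP) (V : nat) psi : bool :=
  match psi with
  | QLab p v => (p \notin qs) && (v < V)
  | QProp q => q \in qs
  | QNeg psi1 | QNext psi1 | QEventually psi1 => separated qs V psi1
  | QOr psi1 psi2 => separated qs V psi1 && separated qs V psi2
  end.

Lemma separated_closed qs V psi vs qs' : separated qs V psi ->
  {subset iota 0 V <= vs} -> {subset qs <= qs'} -> qfree_closed vs qs' psi.
Proof.
move=> + sV sq; elim: psi => //=.
- by move=> p v /andP[_ ltv]; apply: sV; rewrite mem_iota.
- by move=> p IHp q IHq /andP[/IHp -> /IHq ->].
Qed.

Definition msubst (qs : seq AP) F (t : trace AP) : trace AP :=
  fun i => [set p | if p \in qs then F p i else p \in t i]%SET.

(** An unlabeled [q] asks for [q] on every trace of the set. After the substitution all traces carry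
    [F q], and as the set is nonempty the universal statement amounts to the value of [F q]. *)
Lemma sat_ev qs V F tt T Pi i psi : T !=set0 -> separated qs V psi ->
  (forall v, v < V -> Pi v = Some (msubst qs F (tt v))) ->
  qfree_sat (msubst qs F @` T) Pi i psi <-> ev F tt i psi.
Proof.
move=> [t0 Tt0] + HPi; elim: psi i => /=.
- move=> p v i /andP[pq ltv]; rewrite HPi //.
  split=> [[t [<-]]|pt]; first by rewrite inE (negbTE pq).
  by eexists; first reflexivity; rewrite inE (negbTE pq).
- move=> q i qq.
  split=> [/(_ (msubst qs F t0))|Fq _ [t Tt <-]]; last by rewrite inE qq.
  by rewrite inE qq; apply; exists t0.
- by move=> p IH i /IH ->.
- by move=> p IHp q IHq i /andP[/IHp -> /IHq ->].
- by move=> p IH i /IH ->.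
- by move=> p IH i pO; split=> -[j ij Hj]; exists j => //; apply/IH.
Qed.

Definition HAllProps (qs : seq AP) phi := foldr (@HAllProp AP) phi qs.
Definition HExTraces (vs : seq nat) phi := foldr (@HExTrace AP) phi vs.

Lemma sat_HAllProps qs T Pi i phi : uniq qs ->
  hyperqptl_sat T Pi i (HAllProps qs phi) <->
  forall F, hyperqptl_sat (msubst qs F @` T) Pi i phi.
Proof.
elim: qs T => [|q qs IH] T /=.
  move=> _; have H F : msubst [::] F @` T = T.
    rewrite (_ : msubst [::] F = id) ?image_id //.
    by apply/funext => t; apply/funext => j; apply/setP => p; rewrite inE.
  by split=> [HT F|/(_ (fun _ _ => false))]; rewrite H.
move=> /andP[qqs uqs].
have E tq F : (msubst qs F @` (trace_subst q tq @` T)) =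
    msubst (q :: qs) (fun p => if p == q then tq else F p) @` T.
  rewrite image_comp; congr (_ @` T); apply/funext => t; apply/funext => j.
  apply/setP => p; rewrite !inE /trace_subst.
  case: (eqVneq p q) => [->|npq] /=.
    by rewrite (negbTE qqs); case: (tq j); rewrite !inE eqxx.
  by case: ifP => // _; case: (tq j); rewrite !inE (negbTE npq).
split=> [H F|H tq]; last by apply/IH => // F; rewrite E.
have /IH := H (F q) => /(_ uqs F); rewrite E.
by rewrite (_ : (fun p => _) = F) //; apply/funext => p; case: eqP => [->|].
Qed.

Lemma sat_HExTraces vs T Pi i phi : uniq vs ->
  hyperqptl_sat T Pi i (HExTraces vs phi) <->
  exists tt, (forall v, v \in vs -> T (tt v)) /\
    hyperqptl_sat T (fun v => if v \in vs then Some (tt v) else Pi v) i phi.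
Proof.
elim: vs Pi => [|v vs IH] Pi /=.
  by move=> _; split=> [H|[tt [_ H]]] //; exists (fun _ _ => finset.set0).
move=> /andP[vvs uvs]; split.
  move=> [t Tt] /IH [//|tt [Ttt Hphi]]; exists (update tt v t); split.
    by move=> w; rewrite inE /update; case: eqP => //= _; apply: Ttt.
  rewrite (_ : (fun w => _) = (fun w => if w \in vs then Some (tt w) else
      update Pi v (Some t) w)) //.
  apply/funext => w; rewrite inE /update; case: eqP => [->|] //=.
  by rewrite (negbTE vvs).
move=> [tt [Ttt Hphi]]; exists (tt v); first by apply: Ttt; rewrite inE eqxx.
apply/IH => //; exists tt; split=> [w wvs|].
  by apply: Ttt; rewrite inE wvs orbT.
rewrite (_ : (fun w => _) =
  (fun w => if w \in v :: vs then Some (tt w) else Pi w)) //.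
apply/funext => w; rewrite inE /update; case: eqP => [->|] //=.
by rewrite (negbTE vvs).
Qed.

Definition prenex qs M psi : hyperqptl AP :=
  HAllProps qs (HAllTrace 0 (HAllTrace 1 (HAllTrace 2
    (HExTraces (iota 3 M) (HQfree psi))))).

(** The quantified traces are images of traces of [T] under the substitution, which the labelled
    part of the matrix does not notice; so they may be taken from [T] itself. *)
Lemma models_prenex qs M psi T : uniq qs -> separated qs (3 + M) psi ->
  T !=set0 ->
  models T (prenex qs M psi) <-> forall F t0 t1 t2, T t0 -> T t1 -> T t2 ->
    exists tt, [/\ forall v, T (tt v), tt 0 = t0, tt 1 = t1, tt 2 = t2 &
                   ev F tt 0 psi].
Proof.
move=> uqs sep T0; rewrite /models /prenex sat_HAllProps //.
split=> [H F t0 t1 t2 T0' T1 T2|H F _ [t0 T0' <-] _ [t1 T1 <-] _ [t2 T2 <-]].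
  have Hs : hyperqptl_sat (msubst qs F @` T)
      (update (update (update (fun=> None) 0 _) 1 _) 2 _) 0
      (HExTraces (iota 3 M) (HQfree psi)) :=
    H F _ (imageP _ T0') _ (imageP _ T1) _ (imageP _ T2).
  move: Hs; rewrite sat_HExTraces ?iota_uniq // => -[tt' [Ttt Hphi]].
  (* Variables outside the existential block receive an arbitrary trace, to make [tt] total; 0, 1
     and 2 are corrected afterwards. *)
  have /choice[tt Htt] (v : nat) : exists t, T t /\
      (3 <= v < 3 + M -> msubst qs F t = tt' v).
    case: (boolP (3 <= v < 3 + M)) => hv; last by exists t0.
    by have [|t Tt tE] := Ttt v; [rewrite mem_iota | exists t].
  exists (update (update (update tt 0 t0) 1 t1) 2 t2); split=> //.
    move=> v; rewrite /update.
    by do 3![case: eqP => // _]; exact: (Htt v).1.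
  move: Hphi => /= /(sat_ev _ _ sep); apply=> // v ltv.
  rewrite mem_iota /update; case: ifP => hv; last first.
    by move: v ltv hv => [|[|[|v]]] //=; lia.
  move: v hv {ltv} => [|[|[|v]]] // hv.
  by rewrite (Htt v.+3).2.
apply: (iffRL (sat_HExTraces _ _ _ _ (iota_uniq 3 M))).
have [tt [Ttt t0E t1E t2E Hev]] := H F _ _ _ T0' T1 T2.
exists (fun v => msubst qs F (tt v)); split=> [v _|]; first exact: imageP.
apply: (iffRL (@sat_ev qs (3 + M) F tt T _ 0 psi T0 sep _)) => // v ltv.
rewrite mem_iota /update.
case: ifP => hv //; move: v ltv hv => [|[|[|v]]] //=; rewrite ?t0E ?t1E ?t2E //; lia.
Qed.

Lemma prenex_sentence qs M psi : separated qs (3 + M) psi ->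
  sentence (prenex qs M psi).
Proof.
move=> sep; rewrite /sentence /prenex.
have Hex vs qs' ws : hyperqptl_closed ws qs' (HExTraces vs (HQfree psi)) =
    qfree_closed (rev vs ++ ws) qs' psi.
  elim: vs ws => //= v vs IH ws; rewrite IH rev_cons cat_rcons //.
have Hall phi qs' : hyperqptl_closed [::] qs' (HAllProps qs phi) =
    hyperqptl_closed [::] (rev qs ++ qs') phi.
  elim: {sep} qs qs' => //= q qs0 IH qs'; rewrite IH rev_cons cat_rcons //.
rewrite Hall /= Hex; apply: (separated_closed sep) => x.
  rewrite mem_cat mem_rev !mem_iota !inE; lia.
by rewrite cats0 mem_rev.
Qed.

Definition qand psi1 psi2 : qfree AP := QNeg (QOr (QNeg psi1) (QNeg psi2)).
Definition qimp psi1 psi2 : qfree AP := QOr (QNeg psi1) psi2.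
Definition qiff psi1 psi2 : qfree AP := qand (qimp psi1 psi2) (qimp psi2 psi1).
Definition qalways psi : qfree AP := QNeg (QEventually (QNeg psi)).
Definition qeq psi1 psi2 : qfree AP := qalways (qiff psi1 psi2).
(** A shift by one position; on singletons, the first number is the successor of the second. The
    first conjunct deals with position 0, which has no predecessor. *)
Definition qsucc psi1 psi2 : qfree AP :=
  qand (QNeg psi1) (qalways (qiff (QNext psi1) psi2)).
Definition qsingle psi : qfree AP :=
  qand (QEventually psi) (qalways (qimp psi (QNext (qalways (QNeg psi))))).
(** The grammar has no truth constant; [p] merely supplies a proposition for an instance of excluded
    middle. *)
Definition qtrue (p : AP) : qfree AP := QOr (QLab p 0) (QNeg (QLab p 0)).
Fixpoint qall (p : AP) (n : nat) (f : nat -> qfree AP) : qfree AP :=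
  if n is n1.+1 then qand (qall p n1 f) (f n1) else qtrue p.

Definition qguard (p : AP) (b : bool) psi : qfree AP :=
  if b then psi else qtrue p.
Definition qlt psi1 psi2 : qfree AP :=
  QEventually (qand psi1 (QNext (QEventually psi2))).
Definition qmeet psi1 psi2 : qfree AP := QEventually (qand psi1 psi2).

Fixpoint qbits psi (w : seq bool) : qfree AP :=
  if w is b :: w1 then qand (if b then psi else QNeg psi) (QNext (qbits psi w1))
  else QNeg (QEventually psi).

Lemma separated_qall qs V p n f : p \notin qs -> 0 < V ->
  (forall i, i < n -> separated qs V (f i)) -> separated qs V (qall p n f).
Proof.
move=> pq V0; elim: n => [|n IH] H /=; first by rewrite pq V0.
by rewrite IH ?H // => i ltin; apply: H; apply: ltnW.
Qed.

Lemma separated_qbits qs V psi w :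
  separated qs V psi -> separated qs V (qbits psi w).
Proof. by move=> sp; elim: w => //= -[] w /= ->; rewrite sp. Qed.

Section Ev.
Variables (F : AP -> nat -> bool) (tt : nat -> trace AP).
Local Notation ev := (ev F tt).

Definition evset psi : set nat := [set i | ev i psi].

Lemma evsetE psi i : evset psi i = ev i psi.
Proof. by []. Qed.

Lemma ev_next psi i : ev i (QNext psi) = ev i.+1 psi.
Proof. by []. Qed.

Lemma ev_eventually psi i :
  ev i (QEventually psi) = exists2 j, i <= j & ev j psi.
Proof. by []. Qed.

Lemma ev_qand i psi1 psi2 : ev i (qand psi1 psi2) = (ev i psi1 /\ ev i psi2).
Proof. by rewrite /= not_orE !notK. Qed.

Lemma ev_qimp i psi1 psi2 : ev i (qimp psi1 psi2) = (ev i psi1 -> ev i psi2).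
Proof. by rewrite implyE. Qed.

Lemma ev_qiff i psi1 psi2 : ev i (qiff psi1 psi2) = (ev i psi1 <-> ev i psi2).
Proof. by rewrite /qiff ev_qand !ev_qimp. Qed.

Lemma ev_qalways i psi : ev i (qalways psi) = forall j, i <= j -> ev j psi.
Proof.
apply/propext; split=> /= [H j ij|H [j ij]]; last by apply; apply: H.
by apply: contrapT => nj; apply: H; exists j.
Qed.

Lemma ev_qall i p n f : ev i (qall p n f) = forall j, j < n -> ev i (f j).
Proof.
apply/propext; elim: n => [|n IH]; first by split=> // _; exact: EM.
rewrite [qall _ _ _]/= ev_qand IH; split=> [[H Hn] j|H].
  by rewrite ltnS leq_eqVlt => /orP[/eqP ->|/H].
by split=> [j ltj|]; apply: H => //; apply: ltnW.
Qed.

Lemma ev_qeq psi1 psi2 : ev 0 (qeq psi1 psi2) = (evset psi1 = evset psi2).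
Proof.
rewrite ev_qalways; apply/propext; split=> H.
  by apply/funext => i; apply/propext; have := H i (leq0n i); rewrite ev_qiff.
by move=> i _; rewrite ev_qiff -!evsetE H.
Qed.

Definition shift_set (A : set nat) : set nat := [set x | 0 < x /\ A x.-1].

Lemma shift_set1 b : shift_set [set b] = [set b.+1].
Proof. by apply/seteqP; split=> x /=; [move=> [x0 <-]; lia | move=> ->]. Qed.

Lemma ev_qsucc psi1 psi2 :
  ev 0 (qsucc psi1 psi2) = (evset psi1 = shift_set (evset psi2)).
Proof.
rewrite /qsucc ev_qand ev_qalways; apply/propext; split.
  move=> [n1 H]; apply/funext => -[|i]; apply/propext; rewrite /shift_set /=.
    by split=> // -[].
  have := H i (leq0n i); rewrite ev_qiff /= !evsetE => ->.
  by split=> [Hi|[]].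
move=> /funeqP H; split=> [|i _].
  rewrite /= => Hi; have := H 0; rewrite evsetE /shift_set /= => E.
  by move: Hi; rewrite E => -[].
have := H i.+1; rewrite ev_qiff /= evsetE => ->.
by split=> [[]|].
Qed.

Lemma ev_qsingle psi : ev 0 (qsingle psi) = is_single (evset psi).
Proof.
rewrite /qsingle ev_qand ev_qalways; apply/propext; split.
  move=> [[a _ Ha] H]; exists a; apply/seteqP; split=> [b Hb|_ -> //].
  have after x y : ev x psi -> ev y psi -> x < y -> False.
    move=> Hx Hy ltxy; have := H x (leq0n x).
    by rewrite ev_qimp ev_next ev_qalways => /(_ Hx y ltxy).
  by case: (ltngtP a b) => [/(after _ _ Ha Hb)|/(after _ _ Hb Ha)|].
move=> [a aE]; split; first by exists a => //; rewrite -evsetE aE.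
move=> j _; rewrite ev_qimp => Hj.
rewrite ev_next ev_qalways => l ltl Hl.
have : evset psi j by []. have : evset psi l by [].
by rewrite aE /= => la ja; move: ltl; rewrite la ja ltnn.
Qed.

Lemma ev_qguard i p b psi : ev i (qguard p b psi) = (b -> ev i psi).
Proof.
apply/propext; case: b => /=; first by split=> // H; apply: H.
by split=> // _; exact: EM.
Qed.

Lemma ev_qlt psi1 psi2 : ev 0 (qlt psi1 psi2) =
  exists a b, [/\ evset psi1 a, evset psi2 b & a < b].
Proof.
rewrite ev_eventually; apply/propext; split=> [[a _]|[a [b [Ha Hb ltab]]]].
  by rewrite ev_qand => -[Ha [b ltab Hb]]; exists a, b.
by exists a => //; rewrite ev_qand; split=> //; exists b.
Qed.

Lemma ev_qmeet psi1 psi2 : ev 0 (qmeet psi1 psi2) =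
  exists a, evset psi1 a /\ evset psi2 a.
Proof.
rewrite ev_eventually; apply/propext; split=> [[a _]|[a Ha]].
  by rewrite ev_qand; exists a.
by exists a => //; rewrite ev_qand.
Qed.

Lemma ev_qbits psi w :
  ev 0 (qbits psi w) = (evset psi = [set i | nth false w i]).
Proof.
have H i : ev i (qbits psi w) <-> forall j, ev (i + j) psi <-> nth false w j.
  elim: w i => [|b w IH] i.
    split=> [/= H j|H [j ij]].
      by rewrite nth_nil; split=> // Hj; case: H; exists (i + j); rewrite ?leq_addr.
    by move=> Hj; have := H (j - i); rewrite subnKC // nth_nil => /iffLR/(_ Hj).
  rewrite [qbits _ _]/= ev_qand ev_next IH; split.
    move=> [Hb H] [|j] /=; last by rewrite -H addSnnS.
    by rewrite addn0; case: b Hb.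
  move=> H; split; last by move=> j; rewrite addSnnS H.
  by have := H 0; rewrite addn0 /=; case: b {H} => /= ->.
apply/propext; rewrite H; split=> [{}H|{}H j].
  by apply/seteqP; split=> i /=; have := H i; rewrite add0n => <-.
by rewrite add0n -evsetE H.
Qed.

End Ev.

End Prenex.

(** * The sentence describing labelled assignments *)

Fixpoint rbound K (r : rform K) : nat :=
  match r with
  | RAdd i j l | RMul i j l => (maxn i (maxn j l)).*2.+1
  | RLt i j | REq i j | RIn i j => (maxn i j).+1
  | RIn3 i _ => i.+1
  | RNeg r1 => rbound r1
  | ROr r1 r2 => maxn (rbound r1) (rbound r2)
  | REx i r1 => maxn i.+1 (rbound r1)
  end.

Fixpoint subforms K (r : rform K) : seq (rform K) :=
  r :: match r with
       | RNeg r1 | REx _ r1 => subforms r1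
       | ROr r1 r2 => subforms r1 ++ subforms r2
       | _ => [::]
       end.

Section Reduction.
Variables (K : nat) (root : rform K).

Definition ntracks : nat := (rbound root).*2 + 6.
Definition maxprop : nat := ntracks.*2 + 2 + K + size (subforms root).

(* The number p < ntracks stands for the p-th variable of an assignment,
   ntracks + p for the quantified proposition ranging over its values, and
   the remaining propositions for marks, read off at position 0. *)
Definition prop (p : nat) : 'I_maxprop.+1 := inord p.

Local Notation N := ntracks.
Local Notation trace := (trace 'I_maxprop.+1).
Local Notation qfree := (qfree 'I_maxprop.+1).

(** Registers above the variables of [root]; doubling [rbound root] fixes their parity. A, B and C
    are even, hence singletons: marks 0 and 1 tabulate addition and multiplication on them. D is
    odd, hence an arbitrary set: marks [2 + j] tabulate the third-order variables on it. *)
Definition tA : nat := (rbound root).*2.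
Definition tB : nat := (rbound root).*2 + 2.
Definition tC : nat := (rbound root).*2 + 4.
Definition tD : nat := (rbound root).*2 + 1.

Definition qtrack i v : qfree := QLab (prop i) v.
Definition qvalue i : qfree := QProp (prop (N + i)).
Definition qmark k v : qfree := QLab (prop (N.*2 + k)) v.
(** Subformulas are numbered in the preorder of [subforms], after the two arithmetical marks and the
    [K] third-order ones. *)
Definition qsub s v : qfree := qmark (2 + K + s) v.

Definition qagree i v : qfree :=
  qall (prop 0) N (fun j =>
    qguard (prop 0) (j != i) (qeq (qtrack j 0) (qtrack j v))).

(** Trace 0 is the one whose labels are constrained, trace 1 an arbitrary one to compare with. For
    an existential subformula both directions are needed: a marked trace 0 has a witness in the
    variable [4 + s] reserved for this subformula, and any variant trace 1 whose body is marked
    forces the mark of trace 0. *)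
Fixpoint qcond (r : rform K) (s : nat) : qfree :=
  match r with
  | RAdd i j l => qimp (qeq (qtrack i.*2 0) (qtrack tA 1))
      (qimp (qeq (qtrack j.*2 0) (qtrack tB 1))
      (qimp (qeq (qtrack l.*2 0) (qtrack tC 1)) (qiff (qsub s 0) (qmark 0 1))))
  | RMul i j l => qimp (qeq (qtrack i.*2 0) (qtrack tA 1))
      (qimp (qeq (qtrack j.*2 0) (qtrack tB 1))
      (qimp (qeq (qtrack l.*2 0) (qtrack tC 1)) (qiff (qsub s 0) (qmark 1 1))))
  | RLt i j => qiff (qsub s 0) (qlt (qtrack i 0) (qtrack j 0))
  | REq i j => qiff (qsub s 0) (qeq (qtrack i 0) (qtrack j 0))
  | RIn i j => qiff (qsub s 0) (qmeet (qtrack i 0) (qtrack j 0))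
  | RIn3 i j => qimp (qeq (qtrack i 0) (qtrack tD 1))
                  (qiff (qsub s 0) (qmark (2 + j) 1))
  | RNeg r1 => qand (qiff (qsub s 0) (QNeg (qsub s.+1 0))) (qcond r1 s.+1)
  | ROr r1 r2 =>
      let s2 := s.+1 + size (subforms r1) in
      qand (qiff (qsub s 0) (QOr (qsub s.+1 0) (qsub s2 0)))
           (qand (qcond r1 s.+1) (qcond r2 s2))
  | REx i r1 =>
      qand (qand (qimp (qsub s 0) (qand (qsub s.+1 (4 + s)) (qagree i (4 + s))))
                 (qimp (qsub s.+1 1) (qimp (qagree i 1) (qsub s 0))))
           (qcond r1 s.+1)
  end.

Definition qsorted : qfree := qall (prop 0) N (fun i =>
  qguard (prop 0) (~~ odd i) (qsingle (qtrack i 0))).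

(** Trace variable 3 is reserved for this clause. The premise restricts the quantified values to
    families respecting the sorts. *)
Definition qfull : qfree :=
  qimp (qall (prop 0) N (fun i =>
          qguard (prop 0) (~~ odd i) (qsingle (qvalue i))))
       (qall (prop 0) N (fun i => qeq (qtrack i 3) (qvalue i))).

(** The equations a + 0 = a and a + (b + 1) = (a + b) + 1. The bare [qtrack tB 0], read at position
    0, says b = 0 because B is a singleton; trace 1 is a triple already marked as correct. *)
Definition qadd : qfree :=
  qand (qimp (qtrack tB 0) (qiff (qmark 0 0) (qeq (qtrack tA 0) (qtrack tC 0))))
       (qimp (qmark 0 1) (qimp (qeq (qtrack tA 0) (qtrack tA 1))
         (qimp (qsucc (qtrack tB 0) (qtrack tB 1))
               (qiff (qmark 0 0) (qsucc (qtrack tC 0) (qtrack tC 1)))))).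

(** Three traces are needed: with trace 1 marked as (a, b, ab) and trace 0 holding (a, b + 1, c),
    trace 2 holds (ab, a, c), and its addition mark decides whether c = ab + a. *)
Definition qmul : qfree :=
  qand (qimp (qtrack tB 0) (qiff (qmark 1 0) (qtrack tC 0)))
       (qimp (qmark 1 1) (qimp (qeq (qtrack tA 0) (qtrack tA 1))
         (qimp (qsucc (qtrack tB 0) (qtrack tB 1))
         (qimp (qeq (qtrack tA 2) (qtrack tC 1))
         (qimp (qeq (qtrack tB 2) (qtrack tA 0))
         (qimp (qeq (qtrack tC 2) (qtrack tC 0))
               (qiff (qmark 1 0) (qmark 0 2)))))))).

Definition qextensional : qfree := qall (prop 0) K (fun j =>
  qimp (qeq (qtrack tD 0) (qtrack tD 1))
       (qiff (qmark (2 + j) 0) (qmark (2 + j) 1))).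

Definition qrest : qfree :=
  qand qsorted (qand qfull (qand qadd (qand qmul (qand qextensional
    (qcond root 0))))).

Definition qmatrix (w : seq bool) : qfree :=
  qand (qimp (qbits (qtrack 1 0) w) (qsub 0 0)) qrest.

Definition track (t : trace) i : set nat := [set j | prop i \in t j].
Definition mark (t : trace) k : Prop := prop (N.*2 + k) \in t 0.
Definition submark (t : trace) s : Prop := mark t (2 + K + s).
Definition agree i (t t' : trace) : Prop :=
  forall j, j < N -> j != i -> track t j = track t' j.

Fixpoint cond (tt : nat -> trace) (r : rform K) (s : nat) : Prop :=
  match r with
  | RAdd i j l => track (tt 0) i.*2 = track (tt 1) tA ->
      track (tt 0) j.*2 = track (tt 1) tB -> track (tt 0) l.*2 = track (tt 1) tC ->
      (submark (tt 0) s <-> mark (tt 1) 0)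
  | RMul i j l => track (tt 0) i.*2 = track (tt 1) tA ->
      track (tt 0) j.*2 = track (tt 1) tB -> track (tt 0) l.*2 = track (tt 1) tC ->
      (submark (tt 0) s <-> mark (tt 1) 1)
  | RLt i j => submark (tt 0) s <->
      exists a b, [/\ track (tt 0) i a, track (tt 0) j b & a < b]
  | REq i j => submark (tt 0) s <-> track (tt 0) i = track (tt 0) j
  | RIn i j => submark (tt 0) s <->
      exists a, track (tt 0) i a /\ track (tt 0) j a
  | RIn3 i j => track (tt 0) i = track (tt 1) tD ->
      (submark (tt 0) s <-> mark (tt 1) (2 + j))
  | RNeg r1 => (submark (tt 0) s <-> ~ submark (tt 0) s.+1) /\ cond tt r1 s.+1
  | ROr r1 r2 =>
      let s2 := s.+1 + size (subforms r1) in
      (submark (tt 0) s <-> submark (tt 0) s.+1 \/ submark (tt 0) s2) /\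
      (cond tt r1 s.+1 /\ cond tt r2 s2)
  | REx i r1 =>
      ((submark (tt 0) s ->
          submark (tt (4 + s)) s.+1 /\ agree i (tt 0) (tt (4 + s))) /\
       (submark (tt 1) s.+1 -> agree i (tt 0) (tt 1) -> submark (tt 0) s)) /\
      cond tt r1 s.+1
  end.

Definition value (F : 'I_maxprop.+1 -> nat -> bool) i : set nat :=
  [set j | F (prop (N + i)) j].

Definition sorted_cond (t : trace) : Prop :=
  forall i, i < N -> ~~ odd i -> is_single (track t i).

Definition full_cond F (t : trace) : Prop :=
  (forall i, i < N -> ~~ odd i -> is_single (value F i)) ->
  forall i, i < N -> track t i = value F i.

Definition add_cond (t0 t1 : trace) : Prop :=
  (track t0 tB 0 -> (mark t0 0 <-> track t0 tA = track t0 tC)) /\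
  (mark t1 0 -> track t0 tA = track t1 tA ->
   track t0 tB = shift_set (track t1 tB) ->
   (mark t0 0 <-> track t0 tC = shift_set (track t1 tC))).

Definition mul_cond (t0 t1 t2 : trace) : Prop :=
  (track t0 tB 0 -> (mark t0 1 <-> track t0 tC 0)) /\
  (mark t1 1 -> track t0 tA = track t1 tA ->
   track t0 tB = shift_set (track t1 tB) ->
   track t2 tA = track t1 tC -> track t2 tB = track t0 tA ->
   track t2 tC = track t0 tC -> (mark t0 1 <-> mark t2 0)).

Definition extensional_cond (t0 t1 : trace) : Prop :=
  forall j, j < K -> track t0 tD = track t1 tD ->
    (mark t0 (2 + j) <-> mark t1 (2 + j)).

Definition matrix_cond w F (tt : nat -> trace) : Prop :=
  (track (tt 0) 1 = [set i | nth false w i] -> submark (tt 0) 0) /\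
  (sorted_cond (tt 0) /\ (full_cond F (tt 3) /\ (add_cond (tt 0) (tt 1) /\
  (mul_cond (tt 0) (tt 1) (tt 2) /\ (extensional_cond (tt 0) (tt 1) /\
   cond tt root 0))))).

Section Evaluation.
Variables (F : 'I_maxprop.+1 -> nat -> bool) (tt : nat -> trace).

Lemma ev_qagree i v : ev F tt 0 (qagree i v) = agree i (tt 0) (tt v).
Proof.
rewrite ev_qall; apply/propext; split=> H j ltj.
  by move=> nji; have := H j ltj; rewrite ev_qguard ev_qeq; apply.
by rewrite ev_qguard ev_qeq; apply: H.
Qed.

Lemma ev_qcond r s : ev F tt 0 (qcond r s) = cond tt r s.
Proof.
elim: r s => [i j l|i j l|i j|i j|i j|i j|r IH|r1 IH1 r2 IH2|i r IH] s;
  rewrite /qcond -/qcond /cond -/cond.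
- by rewrite !ev_qimp !ev_qeq ev_qiff.
- by rewrite !ev_qimp !ev_qeq ev_qiff.
- by rewrite ev_qiff ev_qlt.
- by rewrite ev_qiff ev_qeq.
- by rewrite ev_qiff ev_qmeet.
- by rewrite ev_qimp ev_qeq ev_qiff.
- by rewrite ev_qand ev_qiff IH.
- by rewrite ev_qand ev_qiff ev_qand IH1 IH2.
- by rewrite 2!ev_qand !ev_qimp ev_qand !ev_qagree IH.
Qed.

Lemma ev_qmatrix w : ev F tt 0 (qmatrix w) = matrix_cond w F tt.
Proof.
rewrite /qmatrix /qrest /matrix_cond ev_qand ev_qimp ev_qbits; congr (_ /\ _).
rewrite ev_qand; congr (_ /\ _).
  rewrite ev_qall; apply/propext; split=> H i ltN.
    by have := H i ltN; rewrite ev_qguard ev_qsingle.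
  by rewrite ev_qguard ev_qsingle; apply: H.
rewrite ev_qand; congr (_ /\ _).
  rewrite ev_qimp !ev_qall; apply/propext; split=> H Hs i ltN.
    have := H _ i ltN; rewrite ev_qeq; apply=> j ltj.
    by rewrite ev_qguard ev_qsingle; apply: Hs.
  rewrite ev_qeq; apply: H => // j ltj.
  by have := Hs j ltj; rewrite ev_qguard ev_qsingle.
rewrite ev_qand; congr (_ /\ _).
  by rewrite ev_qand !ev_qimp !ev_qiff !ev_qsucc !ev_qeq.
rewrite ev_qand; congr (_ /\ _).
  by rewrite ev_qand !ev_qimp !ev_qiff ev_qsucc !ev_qeq.
rewrite ev_qand ev_qcond; congr (_ /\ _).
rewrite ev_qall; apply/propext; split=> H j ltj.
  by have := H j ltj; rewrite ev_qimp ev_qeq ev_qiff.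
by rewrite ev_qimp ev_qeq ev_qiff; apply: H.
Qed.

End Evaluation.

Definition qprops : seq 'I_maxprop.+1 := [seq prop (N + i) | i <- iota 0 N].

Definition reduction_sentence (w : seq bool) : hyperqptl 'I_maxprop.+1 :=
  prenex qprops (1 + size (subforms root)) (qmatrix w).

Lemma tracks_lt : [/\ tA < N, tB < N, tC < N & tD < N].
Proof. by rewrite /tA /tB /tC /tD /N; split; lia. Qed.

Lemma prop_val p : p <= maxprop -> prop p = p :> nat.
Proof. by move=> lep; rewrite inordK. Qed.

Lemma prop_notin p : p <= maxprop -> (p < N) || (N.*2 <= p) ->
  prop p \notin qprops.
Proof.
move=> lep hp; apply/negP => /mapP[i]; rewrite mem_iota => lti.
move/(congr1 val) => /=; rewrite !prop_val //; rewrite ?/maxprop; lia.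
Qed.

Lemma qprops_uniq : uniq qprops.
Proof.
rewrite map_inj_in_uniq ?iota_uniq // => i j; rewrite !mem_iota => lti ltj.
by move/(congr1 val) => /=; rewrite !prop_val /maxprop; lia.
Qed.

Lemma qtrack_notin i : i < N -> prop i \notin qprops.
Proof. by move=> ltN; rewrite prop_notin ?ltN // /maxprop; lia. Qed.

Lemma qmark_notin k : k < 2 + K + size (subforms root) ->
  prop (N.*2 + k) \notin qprops.
Proof. by move=> ltk; rewrite prop_notin /maxprop; lia. Qed.

Lemma subforms_gt0 r : 0 < size (subforms (K:=K) r).
Proof. by case: r. Qed.

Lemma separated_qcond r s : rbound r <= rbound root ->
  s + size (subforms r) <= size (subforms root) ->
  separated qprops (4 + size (subforms root)) (qcond r s).
Proof.
have [hA hB hC hD] := tracks_lt.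
have h0 : 0 < N by rewrite /N; lia.
have hi i : i < rbound root -> i < N by rewrite /N; lia.
have hag i v : v < 4 + size (subforms root) ->
    separated qprops (4 + size (subforms root)) (qagree i v).
  move=> ltv; apply: separated_qall => [||j ltj]; rewrite ?qtrack_notin //.
  by rewrite /qguard; case: ifP => _ /=; rewrite !qtrack_notin //= ltv.
elim: r s => [i j l|i j l|i j|i j|i j|i j|r IH|r1 IH1 r2 IH2|i r IH] s lei les /=;
  rewrite /= in lei les.
- by rewrite !qmark_notin ?qtrack_notin //; first [lia | apply: hi; lia].
- by rewrite !qmark_notin ?qtrack_notin //; first [lia | apply: hi; lia].
- by rewrite !qmark_notin ?qtrack_notin //; first [lia | apply: hi; lia].
- by rewrite !qmark_notin ?qtrack_notin //; first [lia | apply: hi; lia].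
- by rewrite !qmark_notin ?qtrack_notin //; first [lia | apply: hi; lia].
- have ltj := ltn_ord j.
  by rewrite !qmark_notin ?qtrack_notin //; first [lia | apply: hi; lia].
- have sr := subforms_gt0 r.
  by rewrite IH ?qmark_notin //; lia.
- have sr1 := subforms_gt0 r1; have sr2 := subforms_gt0 r2; rewrite size_cat in les.
  by rewrite IH1 ?IH2 ?qmark_notin //; lia.
- have := subforms_gt0 r; rewrite -/(qagree i _) => sr.
  by rewrite IH ?hag ?qmark_notin //; lia.
Qed.

Lemma separated_qmatrix w :
  separated qprops (3 + (1 + size (subforms root))) (qmatrix w).
Proof.
have [hA hB hC hD] := tracks_lt.
have h0 : 0 < N by rewrite /N; lia.
have h1 : 1 < N by rewrite /N; lia.
have hv i : i < N -> prop (N + i) \in qprops.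
  by move=> ltN; apply: map_f; rewrite mem_iota.
have := subforms_gt0 root => hr.
rewrite addnA [3 + 1]/= /qmatrix /=.
rewrite separated_qcond ?separated_qbits /= ?qmark_notin ?qtrack_notin //; try lia.
rewrite !separated_qall ?qtrack_notin //= => i lti.
- by rewrite !qmark_notin ?qtrack_notin //; lia.
- by rewrite /qguard; case: ifP => _ /=; rewrite ?hv ?qtrack_notin.
- by rewrite hv // qtrack_notin.
- by rewrite /qguard; case: ifP => _ /=; rewrite ?hv ?qtrack_notin.
Qed.

Lemma reduction_sentenceP w : sentence (reduction_sentence w).
Proof. exact/prenex_sentence/separated_qmatrix. Qed.

(** The default is a singleton, so that even variables keep their sort beyond the tracks. *)
Definition trace_env (t : trace) : nat -> set nat :=
  fun i => if i < N then track t i else [set 0].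

Lemma trace_env_lt t i : i < N -> trace_env t i = track t i.
Proof. by rewrite /trace_env => ->. Qed.

Lemma trace_env_update t t' i : i < N -> agree i t t' ->
  trace_env t' = update (trace_env t) i (track t' i).
Proof.
move=> ltN ag; apply/funext => j; rewrite /trace_env /update.
case: (eqVneq j i) => [->|nji]; first by rewrite ltN.
by case: ifP => // ltj; rewrite ag.
Qed.

(** * An interpretation read off a model of the sentence *)

Section Soundness.
Variables (w : seq bool) (T : set trace).
Hypothesis T_neq0 : T !=set0.
Hypothesis T_matrix : forall F t0 t1 t2, T t0 -> T t1 -> T t2 ->
  exists tt, [/\ forall v, T (tt v), tt 0 = t0, tt 1 = t1, tt 2 = t2 &
                 matrix_cond w F tt].

(** Instantiate the quantified propositions by [rho]; the trace 3 chosen in response has these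
    tracks. *)
Lemma T_full rho : (forall i, i < N -> ~~ odd i -> is_single (rho i)) ->
  exists t, T t /\ forall i, i < N -> track t i = rho i.
Proof.
move=> srho; have [t0 T0] := T_neq0.
pose F (p : 'I_maxprop.+1) j := `[< rho (p - N) j >].
have vF i : i < N -> value F i = rho i.
  move=> ltN; apply/funext => j; rewrite /value /F /= asboolE prop_val.
    by rewrite addKn.
  by rewrite /maxprop; lia.
have [tt [Ttt _ _ _ [_ [_ [H _]]]]] := T_matrix F T0 T0 T0.
exists (tt 3); split=> // i ltN; rewrite H ?vF // => j ltj oj.
by rewrite vF //; apply: srho.
Qed.

Lemma T_full_ABCD a b c D : exists t, [/\ T t, track t tA = [set a],
  track t tB = [set b], track t tC = [set c] & track t tD = D].
Proof.
pose rho i := if i == tA then [set a] else if i == tB then [set b] else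
  if i == tC then [set c] else if i == tD then D else [set 0].
have [i ltN oi|t [Tt tE]] := @T_full rho.
  rewrite /rho; case: eqP => _; first by exists a.
  case: eqP => _; first by exists b.
  case: eqP => _; first by exists c.
  case: eqP => [iD|_]; last by exists 0.
  by move: oi; rewrite iD /tD; lia.
have [hA hB hC hD] := tracks_lt.
exists t; split=> //; rewrite tE // /rho ?eqxx //.
all: by rewrite /tA /tB /tC /tD; do !case: eqP => //; lia.
Qed.

Lemma T_conds t0 t1 t2 : T t0 -> T t1 -> T t2 ->
  [/\ sorted_cond t0, add_cond t0 t1, mul_cond t0 t1 t2 &
      extensional_cond t0 t1].
Proof.
move=> T0 T1 T2; have := T_matrix (fun _ _ => false) T0 T1 T2.
by move=> [tt [_ <- <- <- [_ [? [_ [? [? [? _]]]]]]]].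
Qed.

(** Induction on b: fullness puts a trace for (a, b, a + b) into [T], the induction hypothesis marks
    it, and the recursion clause compares [t] with it. *)
Lemma T_add t a b c : T t -> track t tA = [set a] -> track t tB = [set b] ->
  track t tC = [set c] -> mark t 0 <-> c = a + b.
Proof.
elim: b t c => [|b IH] t c Tt aE bE cE.
  have [_ [H _] _ _] := T_conds Tt Tt Tt.
  rewrite H ?aE ?bE ?cE // addn0; split=> [/singleton_inj ->|->] //.
have [t1 [T1 a1 b1 c1 _]] := T_full_ABCD a b (a + b) set0.
have m1 : mark t1 0 by apply/(IH _ _ T1 a1 b1 c1).
have [_ [_ H] _ _] := T_conds Tt T1 T1.
rewrite H ?aE ?bE ?cE ?a1 ?b1 ?c1 ?shift_set1 // -addnS.
by split=> [/singleton_inj ->|->].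
Qed.

Lemma T_mul t a b c : T t -> track t tA = [set a] -> track t tB = [set b] ->
  track t tC = [set c] -> mark t 1 <-> c = a * b.
Proof.
elim: b t c => [|b IH] t c Tt aE bE cE.
  have [_ _ [H _] _] := T_conds Tt Tt Tt.
  by rewrite H ?bE // cE muln0 /=; split=> ->.
have [t1 [T1 a1 b1 c1 _]] := T_full_ABCD a b (a * b) set0.
have [t2 [T2 a2 b2 c2 _]] := T_full_ABCD (a * b) a c set0.
have m1 : mark t1 1 by apply/(IH _ _ T1 a1 b1 c1).
have [_ _ [_ H] _] := T_conds Tt T1 T2.
rewrite H ?aE ?bE ?cE ?a1 ?b1 ?c1 ?a2 ?b2 ?c2 ?shift_set1 //.
by rewrite (T_add T2 a2 b2 c2) mulnS addnC.
Qed.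

(** One marked trace is enough: by extensionality all traces with the same register D agree on the
    mark. *)
Definition T_third (j : 'I_K) : set (set nat) :=
  [set A | exists t, [/\ T t, track t tD = A & mark t (2 + j)]].

Lemma T_thirdP t (j : 'I_K) : T t -> mark t (2 + j) <-> T_third j (track t tD).
Proof.
move=> Tt; split=> [mt|[t1 [T1 DE m1]]]; first by exists t.
have [_ _ _ H] := T_conds Tt T1 T1.
by apply/(H j (ltn_ord j) (esym DE)).
Qed.

Lemma T_graph2 (op : nat -> nat -> nat) k :
  (forall t a b c, T t -> track t tA = [set a] -> track t tB = [set b] ->
     track t tC = [set c] -> mark t k <-> c = op a b) ->
  forall t, T t ->
    mark t k <-> graph2 op (track t tA) (track t tB) (track t tC).
Proof.
move=> H t Tt; have [S _ _ _] := T_conds Tt Tt Tt.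
have [hA hB hC hD] := tracks_lt.
have [|a aE] := S _ hA; first by rewrite /tA odd_double.
have [|b bE] := S _ hB; first by rewrite /tB; lia.
have [|c cE] := S _ hC; first by rewrite /tC; lia.
rewrite (H _ _ _ _ Tt aE bE cE) aE bE cE graph2_set1.
by split=> [->|/singleton_inj].
Qed.

Lemma T_submark r s : rbound r <= rbound root ->
  (forall t0 t1, T t0 -> T t1 ->
     exists tt, [/\ forall v, T (tt v), tt 0 = t0, tt 1 = t1 & cond tt r s]) ->
  forall t, T t -> submark t s <-> rsat T_third (trace_env t) r.
Proof.
have hi i : i < rbound root -> i < N by rewrite /N; lia.
have [hA hB hC hD] := tracks_lt.
have third D : exists2 t, T t & track t tD = D.
  by have [t [Tt _ _ _ DE]] := T_full_ABCD 0 0 0 D; exists t.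
have sgl t i : T t -> i.*2 < N -> exists a, track t i.*2 = [set a].
  move=> Tt ltN; have [S _ _ _] := T_conds Tt Tt Tt.
  by apply: S; rewrite ?odd_double.
elim: r s => [i j l|i j l|i j|i j|i j|i j|r IH|r1 IH1 r2 IH2|i r IH] s lei H t Tt;
  rewrite /= in lei.
1,2: have [hli hlj hll] : [/\ i.*2 < N, j.*2 < N & l.*2 < N]
  by split; apply: hi; lia.
1,2: rewrite /= !trace_env_lt //.
1,2: have [[a aE] [b bE] [c cE]] :=
  And3 (sgl _ _ Tt hli) (sgl _ _ Tt hlj) (sgl _ _ Tt hll).
1,2: have [t1 [T1 a1 b1 c1 _]] := T_full_ABCD a b c set0.
1,2: have [tt [_ tt0 tt1 Hc]] := H t t1 Tt T1; move: Hc; rewrite /= tt0 tt1.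
1,2: rewrite aE bE cE a1 b1 c1 => ->; rewrite ?(T_graph2 T_add) ?(T_graph2 T_mul) //.
1,2: by rewrite a1 b1 c1.
1,2,3: have [hli hlj] : i < N /\ j < N by split; apply: hi; lia.
1,2,3: have [tt [_ tt0 _ Hc]] := H t t Tt Tt; move: Hc.
1,2,3: by rewrite /= tt0 !trace_env_lt.
- have hli : i < N by apply: hi; lia.
  have [t1 T1 DE] := third (track t i).
  have [tt [_ tt0 tt1 Hc]] := H t t1 Tt T1; move: Hc.
  by rewrite /= tt0 tt1 DE trace_env_lt // => -> //; rewrite T_thirdP // DE.
- have [tt [_ tt0 _ [Hc _]]] := H t t Tt Tt; move: Hc; rewrite tt0 => -> /=.
  rewrite (IH s.+1) // => t0 t1 T0 T1.
  by have [tt' [? ? ? [_ ?]]] := H t0 t1 T0 T1; exists tt'.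
- have [tt [_ tt0 _ [Hc _]]] := H t t Tt Tt; move: Hc; rewrite tt0 => -> /=.
  rewrite (IH1 s.+1) ?(IH2 (s.+1 + size (subforms r1))) //; try lia.
    by move=> t0 t1 T0 T1; have [tt' [? ? ? [_ [_ ?]]]] := H t0 t1 T0 T1; exists tt'.
  by move=> t0 t1 T0 T1; have [tt' [? ? ? [_ [? _]]]] := H t0 t1 T0 T1; exists tt'.
- have hli : i < N by apply: hi; lia.
  have {}IH : forall t, T t -> submark t s.+1 <-> rsat T_third (trace_env t) r.
    apply: IH => [|t0 t1 T0 T1]; first lia.
    by have [tt' [? ? ? [_ ?]]] := H t0 t1 T0 T1; exists tt'.
  split.
    have [tt [Ttt tt0 _ [[Hc _] _]]] := H t t Tt Tt; move: Hc; rewrite tt0.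
    move=> /[apply] -[/IH -/(_ (Ttt _)) Hr ag]; exists (track (tt (4 + s)) i).
    rewrite -(trace_env_update hli ag); split=> // oi.
    by have [S _ _ _] := T_conds (Ttt (4 + s)) Tt Tt; apply: S.
  move=> [A [sA Hr]].
  (* The witness [A] is merely a set; fullness turns it into a trace of [T] that can play the role
     of trace 1. *)
  have [j ltj oj|t1 [T1 tE]] := @T_full (update (trace_env t) i A).
    rewrite /update; case: eqP => [ji|_]; first by apply: sA; rewrite -ji.
    have [S _ _ _] := T_conds Tt Tt Tt.
    by rewrite trace_env_lt //; apply: S.
  have ag : agree i t t1.
    by move=> j ltj nji; rewrite tE // update_other // trace_env_lt.
  have [tt [_ tt0 tt1 [[_ Hc] _]]] := H t t1 Tt T1.
  move: Hc; rewrite tt0 tt1; apply=> //.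
  apply/IH => //; rewrite (trace_env_update hli ag) tE // update_same.
  exact: Hr.
Qed.

Lemma T_sound : exists Y rho, [/\ forall x, is_single (rho x.*2),
  rho 1 = [set i | nth false w i] & rsat Y rho root].
Proof.
(* Only variable 1 has a prescribed value; giving the digits to all odd variables respects the
   sorts. *)
pose rho i := if odd i then [set i | nth false w i] else [set 0].
have [i ltN oi|t [Tt tE]] := @T_full rho; first by rewrite /rho ifN //; exists 0.
exists T_third, (trace_env t); split.
- move=> x; rewrite /trace_env; case: ifP => [ltN|_]; last by exists 0.
  by rewrite tE // /rho odd_double; exists 0.
- by rewrite trace_env_lt ?tE // /N; lia.
apply/(@T_submark root 0) => //.
  move=> t0 t1 T0 T1; have := T_matrix (fun _ _ => false) T0 T1 T1.
  by move=> [tt [? ? ? _ [_ [_ [_ [_ [_ [_ ?]]]]]]]]; exists tt.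
have [tt [_ tt0 _ _ [H _]]] := T_matrix (fun _ _ => false) Tt Tt Tt.
by rewrite tt0 in H; apply: H; rewrite tE // /N; lia.
Qed.

End Soundness.

(** * A model of the sentence built from an interpretation *)

Section Completeness.
Variables (w : seq bool) (Y : 'I_K -> set (set nat)).
Hypothesis root_sat : forall rho, (forall x, is_single (rho x.*2)) ->
  rho 1 = [set i | nth false w i] -> rsat Y rho root.

(** The model is the set of all such traces. Marks are constrained at position 0 only, where the
    sentence reads them. *)
Definition labelled (t : trace) : Prop :=
  [/\ sorted_cond t,
      mark t 0 <-> graph2 addn (track t tA) (track t tB) (track t tC),
      mark t 1 <-> graph2 muln (track t tA) (track t tB) (track t tC),
      (forall j : 'I_K, mark t (2 + j) <-> Y j (track t tD)) &
      (forall s, s < size (subforms root) ->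
         submark t s <-> rsat Y (trace_env t) (nth root (subforms root) s))].

Lemma labelled_exists rho :
  (forall i, i < N -> ~~ odd i -> is_single (rho i)) ->
  exists t, labelled t /\ forall i, i < N -> track t i = rho i.
Proof.
move=> srho; have [hA hB hC hD] := tracks_lt.
pose env i := if i < N then rho i else [set 0].
pose label k : Prop :=
  if k == 0 then graph2 addn (rho tA) (rho tB) (rho tC)
  else if k == 1 then graph2 muln (rho tA) (rho tB) (rho tC)
  else if insub (k - 2) is Some j then Y j (rho tD)
  else rsat Y env (nth root (subforms root) (k - 2 - K)).
pose t : trace := fun j => [set p : 'I_maxprop.+1 |
  if p < N then `[< rho p j >] else `[< label (p - N.*2) >]]%SET.
have tE i : i < N -> track t i = rho i.
  move=> ltN; apply/funext => j; rewrite /track /= inE prop_val.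
    by rewrite ltN asboolE.
  by rewrite /maxprop; lia.
have mE k : k < 2 + K + size (subforms root) -> mark t k = label k.
  move=> ltk; rewrite /mark inE prop_val; last by rewrite /maxprop; lia.
  by rewrite ifN ?asboolE ?addKn //; lia.
have envE : trace_env t = env.
  by apply/funext => i; rewrite /trace_env /env; case: ifP => // /tE.
exists t; split=> //; split.
- by move=> i ltN oi; rewrite tE //; apply: srho.
- by rewrite mE //= !tE.
- by rewrite mE //= !tE.
- move=> j; have ltj := ltn_ord j; rewrite mE; last lia.
  by rewrite tE // /label addKn valK.
- move=> s lts; rewrite /submark mE; last lia.
  rewrite envE /label.
  have -> : 2 + K + s - 2 = K + s by lia.
  by rewrite insubF ?addKn //; lia.
Qed.

Lemma trace_env_single t : sorted_cond t -> forall x, is_single (trace_env t x.*2).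
Proof.
move=> st x; rewrite /trace_env; case: ifP => [ltN|_]; last by exists 0.
by apply: st; rewrite ?odd_double.
Qed.

Lemma rbound_subforms r s : s < size (subforms r) ->
  rbound (nth root (subforms r) s) <= rbound r.
Proof.
elim: r s => [i j l|i j l|i j|i j|i j|i j|r IH|r1 IH1 r2 IH2|i r IH] [|s] //= lts.
- exact: IH.
- rewrite nth_cat; case: ifP => lts1.
    by rewrite leq_max IH1.
  by rewrite leq_max IH2 ?orbT //; rewrite size_cat in lts; lia.
- by rewrite leq_max IH ?orbT.
Qed.

Lemma nth_subforms0 r : nth root (subforms r) 0 = r.
Proof. by case: r. Qed.

(** Vacuous unless [r] is existential and true at [t0], so that one choice function covers all
    subformulas. *)
Definition witness t0 (t : trace) r : Prop :=
  forall i r1, r = REx i r1 -> rsat Y (trace_env t0) (REx i r1) ->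
    agree i t0 t /\ rsat Y (trace_env t) r1.

Lemma witness_exists t0 s : labelled t0 ->
  exists t, labelled t /\ witness t0 t (nth root (subforms root) s).
Proof.
move=> l0; case E: (nth root _ s) => [i j l|i j l|i j|i j|i j|i j|r|r1 r2|i r].
1,2,3,4,5,6,7,8: by exists t0; split.
have ltN : i < N.
  have : rbound (nth root (subforms root) s) <= rbound root.
    case: (ltnP s (size (subforms root))) => hs; first exact: rbound_subforms.
    by rewrite nth_default.
  by rewrite E /= /N; lia.
case: (EM (rsat Y (trace_env t0) (REx i r))) => [[A [sA Hr]]|nr]; last first.
  by exists t0; split=> // i' r' <-.
have [j ltj oj|t [lt tE]] := @labelled_exists (update (trace_env t0) i A).
  rewrite /update; case: eqP => [ji|_]; first by apply: sA; rewrite -ji.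
  by rewrite trace_env_lt //; case: l0 => + _ _ _ _; apply.
exists t; split=> // i' r' [<- <-] _.
have ag : agree i t0 t.
  by move=> j ltj nji; rewrite tE // update_other // trace_env_lt.
split=> //; rewrite (trace_env_update ltN ag) tE // update_same.
exact: Hr.
Qed.

(** The assumptions on marks and witnesses are relative to the offset [s], so that they restrict to
    both operands of a disjunction. *)
Lemma labelled_cond tt r s : rbound r <= rbound root ->
  (forall v, labelled (tt v)) ->
  (forall j v, j < size (subforms r) ->
     submark (tt v) (s + j) <->
     rsat Y (trace_env (tt v)) (nth root (subforms r) j)) ->
  (forall j, j < size (subforms r) ->
     witness (tt 0) (tt (4 + (s + j))) (nth root (subforms r) j)) ->
  cond tt r s.
Proof.
move=> + ltt; have hi i : i < rbound root -> i < N by rewrite /N; lia.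
elim: r s => [i j l|i j l|i j|i j|i j|i j|r IH|r1 IH1 r2 IH2|i r IH] s lei Hm Hw;
  have := Hm 0 0 (subforms_gt0 _); rewrite addn0 /= in lei * => E0.
1,2: move: E0; rewrite !trace_env_lt; try by apply: hi; lia.
1,2: by case: (ltt 1) => _ H0 H1 _ _ E0 Ei Ej El; rewrite E0 ?H0 ?H1 Ei Ej El.
1,2,3: by move: E0; rewrite !trace_env_lt //; apply: hi; lia.
- move: E0; rewrite trace_env_lt; last by apply: hi; lia.
  by case: (ltt 1) => _ _ _ H _ E0 Ei; rewrite E0 H Ei.
- have E1 v := Hm 1 v (subforms_gt0 r); rewrite addn1 /= in E1.
  split; first by rewrite E0 E1 nth_subforms0.
  apply: IH => // [j v ltj|j ltj]; rewrite (addSnnS s j); first exact: Hm.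
  exact: Hw j.+1 ltj.
- have ss := size_cat (subforms r1) (subforms r2).
  have sr1 := subforms_gt0 r1; have sr2 := subforms_gt0 r2.
  have E1 : forall j v, j < size (subforms r1) -> submark (tt v) (s.+1 + j) <->
      rsat Y (trace_env (tt v)) (nth root (subforms r1) j).
    move=> j v ltj; rewrite (_ : s.+1 + j = s + j.+1); last lia.
    by rewrite Hm /= ?ss ?nth_cat ?ltj //; lia.
  have E2 : forall j v, j < size (subforms r2) ->
      submark (tt v) (s.+1 + size (subforms r1) + j) <->
      rsat Y (trace_env (tt v)) (nth root (subforms r2) j).
    move=> j v ltj.
    rewrite (_ : _ + j = s + (size (subforms r1) + j).+1); last lia.
    by rewrite Hm /= ?ss ?nth_cat ?ifN ?addKn //; lia.
  split.
    have := E1 0 0 sr1; have := E2 0 0 sr2; rewrite !addn0 => -> ->.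
    by rewrite E0 !nth_subforms0.
  split; [apply: IH1 => //|apply: IH2 => //]; try lia.
    move=> j ltj; rewrite (_ : s.+1 + j = s + j.+1); last lia.
    by have := Hw j.+1; rewrite /= ss nth_cat ltj; apply; lia.
  move=> j ltj; rewrite (_ : _ + j = s + (size (subforms r1) + j).+1); last lia.
  have := Hw (size (subforms r1) + j).+1; rewrite /= ss nth_cat ifN ?addKn; last lia.
  by apply; lia.
- have E1 v := Hm 1 v (subforms_gt0 r); rewrite addn1 /= nth_subforms0 in E1.
  have ltN : i < N by apply: hi; lia.
  split; last first.
    apply: IH => [|j v ltj|j ltj]; first by move: lei; rewrite geq_max => /andP[].
      by rewrite (addSnnS s j); apply: Hm j.+1 v ltj.
    by rewrite (addSnnS s j); apply: Hw j.+1 ltj.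
  split.
    move=> /E0 Hr; have := Hw 0 isT; rewrite addn0 => /(_ i r erefl Hr) [ag Hr1].
    by split=> //; apply/E1.
  move=> /E1 Hr ag; apply/E0; exists (track (tt 1) i).
  rewrite -(trace_env_update ltN ag); split=> // oi.
  by case: (ltt 1) => + _ _ _ _; apply.
Qed.

Lemma labelled_values t : labelled t -> exists a b c,
  [/\ track t tA = [set a], track t tB = [set b], track t tC = [set c],
      mark t 0 <-> c = a + b & mark t 1 <-> c = a * b].
Proof.
move=> [S H0 H1 _ _]; have [hA hB hC hD] := tracks_lt.
have [|a aE] := S _ hA; first by rewrite /tA odd_double.
have [|b bE] := S _ hB; first by rewrite /tB; lia.
have [|c cE] := S _ hC; first by rewrite /tC; lia.
exists a, b, c; split=> //; [rewrite H0|rewrite H1]; rewrite aE bE cE graph2_set1.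
all: by split=> [/singleton_inj|->].
Qed.

Lemma labelled_matrix F t0 t1 t2 : labelled t0 -> labelled t1 -> labelled t2 ->
  exists tt, [/\ forall v, labelled (tt v), tt 0 = t0, tt 1 = t1, tt 2 = t2 &
                 matrix_cond w F tt].
Proof.
move=> l0 l1 l2; have h1 : 1 < N by rewrite /N; lia.
have [t3 [l3 H3]] : exists t3, labelled t3 /\ full_cond F t3.
  case: (EM (forall i, i < N -> ~~ odd i -> is_single (value F i))) => [sF|nF].
    by have [t [lt tE]] := labelled_exists sF; exists t; split=> // _.
  by exists t0; split=> // /nF.
have /choice[tw Htw] s := witness_exists s l0.
pose tt v := match v with
  | 0 => t0 | 1 => t1 | 2 => t2 | 3 => t3 | v1.+4 => tw v1 end.
have ltt v : labelled (tt v) by case: v => [|[|[|[|v]]]] //=; case: (Htw v).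
exists tt; split=> //; rewrite /matrix_cond /=.
split.
  move=> E; case: (l0) => S _ _ _ H; apply/(H 0 (subforms_gt0 root)).
  rewrite nth_subforms0; apply: root_sat; first exact: trace_env_single.
  by rewrite trace_env_lt.
split; first by case: l0.
split=> //.
have [a0 [b0 [c0 [a0E b0E c0E m00 m01]]]] := labelled_values l0.
have [a1 [b1 [c1 [a1E b1E c1E m10 m11]]]] := labelled_values l1.
have [a2 [b2 [c2 [a2E b2E c2E m20 m21]]]] := labelled_values l2.
split.
  rewrite /add_cond a0E b0E c0E a1E b1E c1E !shift_set1 m00 m10.
  split=> [/= <-|-> /singleton_inj -> /singleton_inj ->].
    by rewrite addn0; split=> [->|/singleton_inj].
  by rewrite addnS; split=> [->|/singleton_inj].
split.
  rewrite /mul_cond a0E b0E c0E a1E b1E c1E a2E b2E c2E !shift_set1 m01 m11 m20.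
  split=> [/= <-|-> /singleton_inj -> /singleton_inj ->].
    by rewrite muln0; split=> [->|<-].
  move=> /singleton_inj -> /singleton_inj -> /singleton_inj ->.
  by rewrite mulnS addnC.
split.
  move=> j ltj E; case: l0 l1 => _ _ _ H0 _ [_ _ _ H1 _].
  by rewrite (H0 (Ordinal ltj)) (H1 (Ordinal ltj)) E.
apply: labelled_cond => // [s v lts|s lts].
  by case: (ltt v) => _ _ _ _ H; apply: H.
by case: (Htw s).
Qed.

End Completeness.

Lemma reduction_sound w : satisfiable (reduction_sentence w) ->
  exists Y rho, [/\ forall x, is_single (rho x.*2),
    rho 1 = [set i | nth false w i] & rsat Y rho root].
Proof.
move=> [T T0 /(models_prenex qprops_uniq (separated_qmatrix w) T0) H].
apply: (T_sound T0) => F t0 t1 t2 T0' T1 T2.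
have [tt [? ? ? ?]] := H F t0 t1 t2 T0' T1 T2.
by rewrite ev_qmatrix; exists tt.
Qed.

(** Every [rho] is needed, since the matrix demands the root mark on each trace whose variable 1
    holds [w], whereas soundness yields one [rho] only. The gap closes for [decode_formula], whose
    truth depends on variable 1 and [Y] alone. *)
Lemma reduction_complete w Y :
  (forall rho, (forall x, is_single (rho x.*2)) ->
     rho 1 = [set i | nth false w i] -> rsat Y rho root) ->
  satisfiable (reduction_sentence w).
Proof.
move=> H.
have T0 : [set t | labelled Y t] !=set0.
  by have [i _ _|t [lt _]] := @labelled_exists Y (fun=> [set 0]); [exists 0|exists t].
exists [set t | labelled Y t] => //.
apply/(models_prenex qprops_uniq (separated_qmatrix w) T0) => F t0 t1 t2 l0 l1 l2.
have [tt [? ? ? ? ?]] := labelled_matrix H F l0 l1 l2.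
by exists tt; rewrite ev_qmatrix.
Qed.

(** * The sentence as a transduction of the digits *)

Definition bit_chunk (b : bool) : seq nat :=
  [:: 2; 3; 2] ++ (if b then [:: 0; 1; 0] else [:: 2; 0; 1; 0]) ++ [:: 2; 4].

(** The conjunctions nest to the right and prefix notation closes no brackets, so a digit
    contributes a block depending neither on its position nor on the length of the word. *)
Lemma polish_qbits w : qfree_polish (qbits (qtrack 1 0) w) =
  flatten (map bit_chunk w) ++ [:: 2; 5; 0; 1; 0].
Proof.
have p1 : prop 1 = 1 :> nat by rewrite prop_val // /maxprop; lia.
elim: w => [|b w IH]; first by rewrite /= p1.
by rewrite /= -catA -IH; case: b => /=; rewrite p1.
Qed.

Lemma reduction_polish : exists pre suf, forall w,
  hyperqptl_polish (reduction_sentence w) =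
  pre ++ flatten (map bit_chunk w) ++ suf.
Proof.
have Hall qs phi : hyperqptl_polish (HAllProps qs phi) =
    flatten [seq [:: 9; val q] | q : 'I_maxprop.+1 <- qs] ++ hyperqptl_polish phi.
  by elim: qs => //= q qs ->.
have Hex vs phi : hyperqptl_polish (HExTraces (AP := 'I_maxprop.+1) vs phi) =
    flatten [seq [:: 6; v] | v <- vs] ++ hyperqptl_polish phi.
  by elim: vs => //= v vs ->.
exists (flatten [seq [:: 9; val q] | q <- qprops] ++
  [:: 7; 0; 7; 1; 7; 2] ++
  flatten [seq [:: 6; v] | v <- iota 3 (1 + size (subforms root))] ++
  [:: 2; 3; 2; 3; 2]).
exists ([:: 2; 5; 0; 1; 0] ++ qfree_polish (qsub 0 0) ++ 2 :: qfree_polish qrest).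
move=> w; rewrite /reduction_sentence /prenex Hall -!catA; congr (_ ++ _).
have -> phi : hyperqptl_polish (HAllTrace 0 (HAllTrace 1 (HAllTrace 2 phi))) =
    [:: 7; 0; 7; 1; 7; 2] ++ hyperqptl_polish phi :> seq nat by [].
rewrite Hex; do 2!congr (_ ++ _).
have -> : hyperqptl_polish (HQfree (qmatrix w)) = [:: 2; 3; 2; 3; 2] ++
    (qfree_polish (qbits (qtrack 1 0) w) ++ qfree_polish (qsub 0 0)) ++
    2 :: qfree_polish qrest by [].
by rewrite polish_qbits -!catA.
Qed.

End Reduction.

(** * The polynomial-time reduction *)

Lemma bitset_inj : injective bitset.
Proof.
suff H B n n' : n <= B -> n' <= B -> bitset n = bitset n' -> n = n'.
  by move=> n n'; apply: (H (n + n')); rewrite ?leq_addr ?leq_addl.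
elim: B n n' => [|B IH] n n' leB leB' E; first by lia.
have bE i : odd (n %/ 2 ^ i) = odd (n' %/ 2 ^ i).
  by apply/idP/idP; rewrite -!bitsetE E.
have hE : n./2 = n'./2.
  apply: IH; [lia|lia|]; apply/funext => i.
  by rewrite !bitsetE -!divn2 -!divnMA -expnS bE.
by have := bE 0; rewrite !divn1; lia.
Qed.

(** The sentence prescribes a set rather than a number: n arrives as set variable 0, which is
    variable 1 of the relational form, and the free number variable of [psi] is recovered from its
    digits. *)
Definition decode_formula K (psi : arith K) : arith K :=
  AEx1 0 (AAnd (bits_formula K) psi).

Lemma sat_decode_formula K (psi : arith K) e1 e2 Y n :
  arith_closed [:: 0] [::] psi -> e2 0 = bitset n ->
  arith_sat e1 e2 Y (decode_formula psi) <->
  arith_sat (update (fun=> 0) 0 n) (fun=> set0) Y psi.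
Proof.
move=> cl eE.
have cE a : arith_sat (update e1 0 a) e2 Y psi <->
    arith_sat (update (fun=> 0) 0 a) (fun=> set0) Y psi.
  by apply: (arith_sat_closed Y cl) => // x; rewrite inE => /eqP ->.
apply: iff_trans (sat_AEx1 (fun a => sat_AAnd (sat_bits_formula _ _ _) (cE a))) _.
rewrite eE /update /=; split=> [[a [/bitset_inj <-]]|] // Hn.
by exists n.
Qed.

Lemma hyperqptl_hard A : Sigma21 A -> poly_reducible A hyperqptl_satisfiability.
Proof.
move=> [K [psi [cl AE]]].
pose root := rform_of_arith (decode_formula psi).
have [pre [suf pE]] := reduction_polish root.
exists (fun n => hyperqptl_code (reduction_sentence root (bits n))).
  pose u s := flatten (map unary s).
  (* The prefix includes the coded size of AP; the final [true] is the leading digit that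
     [nat_of_word] adds. *)
  apply: (@poly_time_transducer _ (u (maxprop root :: pre)) (rcons (u suf) true)
            (fun b => u (bit_chunk b))) => n.
  rewrite /hyperqptl_code bits_nat_of_word pE -cat_cons !map_cat !flatten_cat.
  rewrite /u !rcons_cat; congr (_ ++ (_ ++ _)).
  by elim: (bits n) => //= b w IH; rewrite map_cat flatten_cat IH.
move=> n; rewrite AE /=; split.
  move=> [Y HY]; exists (maxprop root), (reduction_sentence root (bits n)).
  split=> //; first exact: reduction_sentenceP.
  apply: (@reduction_complete _ _ _ Y) => rho /choice[e1 e1E] rho1.
  apply/(@rsat_rform_of_arith _ _ _ _ e1 (fun X => rho X.*2.+1)) => //.
  exact/(@sat_decode_formula _ psi e1 (fun X => rho X.*2.+1) Y n cl rho1).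
move=> [m [phi [_ /hyperqptl_code_inj E]]].
(* The types of [phi] and of the reduction's sentence are only equal through [E], so satisfiability
   is transported along dependent pairs. *)
pose sat_tagged (t : {k & hyperqptl 'I_k.+1}) := satisfiable (tagged t).
rewrite -[satisfiable phi]/(sat_tagged (Tagged _ phi)) -E.
move=> /reduction_sound [Y [rho [/choice[e1 e1E] rho1 Hr]]]; exists Y.
apply/(@sat_decode_formula _ psi e1 (fun X => rho X.*2.+1) Y n cl rho1).
exact/(@rsat_rform_of_arith _ _ _ rho).
Qed.

(** * The formula defining satisfiability *)

Definition pow_graph : set nat := [set x | exists a, x = pair_nat a (2 ^ a)].

Definition push_code a c c1 : Prop :=
  exists b, pow_graph (pair_nat a b) /\ c + 1 = b * (c1 + c1 + 1).

Lemma push_codeP a c s : push_code a c (seq_code s) <-> c = seq_code (a :: s).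
Proof.
have E := seq_code_cons a s; split.
  by move=> [b [[a' /pair_nat_inj [<- ->]]]]; rewrite addnn !addn1 -E => -[].
by move=> ->; exists (2 ^ a); split; [exists a|rewrite addnn !addn1 E].
Qed.

(** Holds for arbitrary numbers, and thus bounds [c1] before it is known to be a code; the
    inductions on codes need this. *)
Lemma push_code_eq a c c1 : push_code a c c1 -> 2 ^ a * c1.*2.+1 = c.+1.
Proof. by move=> [b [[a' /pair_nat_inj [<- ->]]]]; rewrite addnn !addn1. Qed.

(* An environment is a set E of numbers: <0, v> marks the trace variable v as
   bound, <1, q> the proposition q as quantified, <2, <i, q>> gives the value of
   a quantified q at position i, and <3, <v, <i, p>>> puts p at position i of the
   trace bound to v. *)
Definition env_var (E : set nat) v := E (pair_nat 0 v).
Definition env_prop (E : set nat) q := E (pair_nat 1 q).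
Definition env_val (E : set nat) i q := E (pair_nat 2 (pair_nat i q)).
Definition env_trace (E : set nat) v i p :=
  E (pair_nat 3 (pair_nat v (pair_nat i p))).

Definition overridden (E X : set nat) i p : Prop :=
  env_prop E p /\ env_val E i p \/ ~ env_prop E p /\ X (pair_nat i p).

(** A trace is stored with the overrides in force when it is bound: later propositional quantifiers
    change the set of traces, not the traces already assigned. *)
Definition bind_trace (E : set nat) v (X : set nat) : set nat := [set y |
  y = pair_nat 0 v \/
  (exists i p, y = pair_nat 3 (pair_nat v (pair_nat i p)) /\ overridden E X i p) \/
  E y /\ ~ exists x, y = pair_nat 3 (pair_nat v x)].

Definition bind_prop (E : set nat) q (A : set nat) : set nat := [set y |
  y = pair_nat 1 q \/
  (exists i, y = pair_nat 2 (pair_nat i q) /\ A i) \/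
  E y /\ ~ exists i, y = pair_nat 2 (pair_nat i q)].

(** Packs a pair into one set of numbers, the kind of object to which a third-order variable
    applies. *)
Definition state_set c (E : set nat) : set nat := [set x |
  x = pair_nat 0 c \/ exists y, x = pair_nat 1 y /\ E y].

Definition in_table (S : set nat) c d i b :=
  S (pair_nat c (pair_nat d (pair_nat i b))).

(* <c, d, i, b> in S reads: c codes psi followed by the list coded by d, psi is
   closed in E, and psi has truth value b at position i. *)
Definition qfree_step m E S c d i b : Prop :=
  (exists p v c1 c2, push_code 0 c c1 /\ push_code p c1 c2 /\ push_code v c2 d /\
     p < m + 1 /\ env_var E v /\
     (b = 1 /\ env_trace E v i p \/ b = 0 /\ ~ env_trace E v i p)) \/
  (exists q c1, push_code 1 c c1 /\ push_code q c1 d /\ q < m + 1 /\ env_prop E q /\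
     (b = 1 /\ env_val E i q \/ b = 0 /\ ~ env_val E i q)) \/
  (exists c1 b1, push_code 2 c c1 /\ in_table S c1 d i b1 /\ b + b1 = 1) \/
  (exists c1 c2 b1 b2, push_code 3 c c1 /\ c2 < c /\
     in_table S c1 c2 i b1 /\ in_table S c2 d i b2 /\
     (b = 1 /\ (b1 = 1 \/ b2 = 1) \/ b = 0 /\ b1 = 0 /\ b2 = 0)) \/
  (exists c1, push_code 4 c c1 /\ in_table S c1 d (i + 1) b) \/
  (exists c1, push_code 5 c c1 /\
     (b = 1 /\ (exists j, i < j + 1 /\ in_table S c1 d j 1) \/
      b = 0 /\ forall j, i < j + 1 -> in_table S c1 d j 0)).

Definition qfree_true m E c : Prop :=
  exists S, in_table S c 1 0 1 /\
    forall c d i b, in_table S c d i b -> qfree_step m E S c d i b.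

(** The environment is given by a predicate, so that a formula can describe an updated environment
    in place. *)
Definition in_states (Y1 : set (set nat)) c (P : nat -> Prop) : Prop :=
  exists Z : set nat,
    (forall x, (Z x -> x = pair_nat 0 c \/ exists y, x = pair_nat 1 y /\ P y) /\
               (x = pair_nat 0 c \/ (exists y, x = pair_nat 1 y /\ P y) -> Z x)) /\
    Y1 Z.

Lemma in_statesE Y1 c E : in_states Y1 c E <-> Y1 (state_set c E).
Proof.
split=> [[Z [ZE YZ]]|HY]; last by exists (state_set c E).
rewrite (_ : state_set c E = Z) //.
by apply/seteqP; split=> x; [exact: (ZE x).2 | exact: (ZE x).1].
Qed.

Definition hyperqptl_step m (Y0 Y1 : set (set nat)) c E : Prop :=
  (exists v c1 c2, push_code 6 c c1 /\ push_code v c1 c2 /\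
     exists X, Y0 X /\ in_states Y1 c2 (bind_trace E v X)) \/
  (exists v c1 c2, push_code 7 c c1 /\ push_code v c1 c2 /\
     forall X, Y0 X -> in_states Y1 c2 (bind_trace E v X)) \/
  (exists q c1 c2, push_code 8 c c1 /\ push_code q c1 c2 /\ q < m + 1 /\
     exists A, in_states Y1 c2 (bind_prop E q A)) \/
  (exists q c1 c2, push_code 9 c c1 /\ push_code q c1 c2 /\ q < m + 1 /\
     forall A, in_states Y1 c2 (bind_prop E q A)) \/
  qfree_true m E c.

Definition sat_certificate (Y0 Y1 : set (set nat)) n : Prop :=
  (exists X, Y0 X) /\
  exists m c, push_code m n c /\ (exists E, (forall x, ~ E x) /\ in_states Y1 c E) /\
    forall c E, in_states Y1 c E -> hyperqptl_step m Y0 Y1 c E.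

Section Formula.
Local Notation "'#' x" := (TVar x) (at level 0, x at level 0).
Local Infix "/&/" := (@AAnd 2) (at level 80, right associativity).
Local Infix "/|/" := (@AOr 2) (at level 85, right associativity).
Local Infix "=i=" := (@AEq 2) (at level 70).
Local Infix "<i<" := (@ALt 2) (at level 70).
Local Infix "+i+" := TAdd (at level 50, left associativity).
Local Notation "t 'inset' X" := (@AIn2 2 t X) (at level 70).

(* Number variables: 0 is n, 1 and 2 hold the constants 0 and 1, 3 is m.
   Set variables: 0 is [pow_graph], 1 is E, 2 is S, 4 is a state. *)
Fixpoint num (k : nat) : term := if k is k1.+1 then #2 +i+ num k1 else #1.

Definition a_push (a c c1 : term) : arith 2 :=
  AEx1 30 (TPair a #30 inset 0 /&/
           c +i+ #2 =i= TMul #30 (c1 +i+ c1 +i+ #2)).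

Definition a_env (tag : nat) (t : term) : arith 2 := TPair (num tag) t inset 1.
Definition a_var v := a_env 0 v.
Definition a_prop q := a_env 1 q.
Definition a_val i q := a_env 2 (TPair i q).
Definition a_trace v i p := a_env 3 (TPair v (TPair i p)).

Definition a_table (c d i b : term) : arith 2 :=
  TPair c (TPair d (TPair i b)) inset 2.

Definition a_qfree_step : arith 2 :=
  let c := #4 in let d := #5 in let i := #6 in let b := #7 in
  AEx1 8 (AEx1 9 (AEx1 10 (AEx1 11 (
     a_push (num 0) c #10 /&/ a_push #8 #10 #11 /&/ a_push #9 #11 d /&/
     #8 <i< #3 +i+ #2 /&/ a_var #9 /&/
     (b =i= num 1 /&/ a_trace #9 i #8 /|/
      b =i= num 0 /&/ ANeg (a_trace #9 i #8)))))) /|/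
  AEx1 8 (AEx1 10 (
     a_push (num 1) c #10 /&/ a_push #8 #10 d /&/ #8 <i< #3 +i+ #2 /&/
     a_prop #8 /&/
     (b =i= num 1 /&/ a_val i #8 /|/ b =i= num 0 /&/ ANeg (a_val i #8)))) /|/
  AEx1 10 (AEx1 12 (
     a_push (num 2) c #10 /&/ a_table #10 d i #12 /&/ b +i+ #12 =i= num 1)) /|/
  AEx1 10 (AEx1 11 (AEx1 12 (AEx1 13 (
     a_push (num 3) c #10 /&/ #11 <i< c /&/
     a_table #10 #11 i #12 /&/ a_table #11 d i #13 /&/
     (b =i= num 1 /&/ (#12 =i= num 1 /|/ #13 =i= num 1) /|/
      b =i= num 0 /&/ #12 =i= num 0 /&/ #13 =i= num 0))))) /|/
  AEx1 10 (a_push (num 4) c #10 /&/ a_table #10 d (i +i+ #2) b) /|/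
  AEx1 10 (a_push (num 5) c #10 /&/
     (b =i= num 1 /&/ AEx1 14 (i <i< #14 +i+ #2 /&/ a_table #10 d #14 (num 1)) /|/
      b =i= num 0 /&/
        AAll1 14 (AImp (i <i< #14 +i+ #2) (a_table #10 d #14 (num 0))))).

Definition a_qfree_true : arith 2 :=
  AEx2 2 (a_table #4 (num 1) (num 0) (num 1) /&/
    AAll1 4 (AAll1 5 (AAll1 6 (AAll1 7
      (AImp (a_table #4 #5 #6 #7) a_qfree_step))))).

(* [mem] describes the environment: it has the free variable 21. *)
Definition a_states (c : term) (mem : arith 2) : arith 2 :=
  let rhs := #20 =i= TPair (num 0) c /|/
             AEx1 21 (#20 =i= TPair (num 1) #21 /&/ mem) in
  AEx2 4 (AAll1 20 (AImp (#20 inset 4) rhs /&/ AImp rhs (#20 inset 4)) /&/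
          AIn3 4 (ord_max : 'I_2)).

Definition a_bind_trace : arith 2 :=
  #21 =i= TPair (num 0) #8 /|/
  AEx1 22 (AEx1 23 (#21 =i= TPair (num 3) (TPair #8 (TPair #22 #23)) /&/
    (a_prop #23 /&/ a_val #22 #23 /|/
     ANeg (a_prop #23) /&/ TPair #22 #23 inset 3))) /|/
  #21 inset 1 /&/ ANeg (AEx1 22 (#21 =i= TPair (num 3) (TPair #8 #22))).

Definition a_bind_prop : arith 2 :=
  #21 =i= TPair (num 1) #8 /|/
  AEx1 22 (#21 =i= TPair (num 2) (TPair #22 #8) /&/ #22 inset 3) /|/
  #21 inset 1 /&/ ANeg (AEx1 22 (#21 =i= TPair (num 2) (TPair #22 #8))).

Definition a_hyperqptl_step : arith 2 :=
  let c := #4 in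
  AEx1 8 (AEx1 9 (AEx1 10 (a_push (num 6) c #9 /&/ a_push #8 #9 #10 /&/
    AEx2 3 (AIn3 3 ord0 /&/ a_states #10 a_bind_trace)))) /|/
  AEx1 8 (AEx1 9 (AEx1 10 (a_push (num 7) c #9 /&/ a_push #8 #9 #10 /&/
    AAll2 3 (AImp (AIn3 3 ord0) (a_states #10 a_bind_trace))))) /|/
  AEx1 8 (AEx1 9 (AEx1 10 (a_push (num 8) c #9 /&/ a_push #8 #9 #10 /&/
    #8 <i< #3 +i+ #2 /&/ AEx2 3 (a_states #10 a_bind_prop)))) /|/
  AEx1 8 (AEx1 9 (AEx1 10 (a_push (num 9) c #9 /&/ a_push #8 #9 #10 /&/
    #8 <i< #3 +i+ #2 /&/ AAll2 3 (a_states #10 a_bind_prop)))) /|/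
  a_qfree_true.

Definition a_certificate : arith 2 :=
  AEx2 3 (AIn3 3 ord0) /&/
  AEx1 3 (AEx1 4 (a_push #3 #0 #4 /&/
    AEx2 1 (AAll1 8 (ANeg (#8 inset 1)) /&/ a_states #4 (#21 inset 1)) /&/
    AAll1 4 (AAll2 1 (AImp (a_states #4 (#21 inset 1)) a_hyperqptl_step)))).

Definition a_prelude : arith 2 :=
  #1 +i+ #1 =i= #1 /&/ TMul #2 #2 =i= #2 /&/ #1 <i< #2 /&/
  AAll1 8 (AImp (#8 inset 0)
    (#8 =i= TPair #1 #2 /|/ AEx1 9 (AEx1 10 (TPair #9 #10 inset 0 /&/
       #8 =i= TPair (#9 +i+ #2) (#10 +i+ #10))))) /&/
  TPair #1 #2 inset 0 /&/
  AAll1 9 (AAll1 10 (AImp (TPair #9 #10 inset 0)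
    (TPair (#9 +i+ #2) (#10 +i+ #10) inset 0))).

Definition a_satisfiability : arith 2 :=
  AEx1 1 (AEx1 2 (AEx2 0 (a_prelude /&/ a_certificate))).

End Formula.

(** The predicates above mirror the formula literally, down to [p < m + 1] and [i < j + 1].
    Variables 1 and 2 already hold 0 and 1, so each [num k] evaluates to [k] by conversion. *)
Lemma sat_a_certificate n (Y : 'I_2 -> set (set nat)) :
  arith_sat (update (update (update (fun=> 0) 0 n) 1 0) 2 1)
    (update (fun=> set0) 0 pow_graph) Y a_certificate <->
  sat_certificate (Y ord0) (Y ord_max) n.
Proof.
rewrite /a_certificate /a_hyperqptl_step /a_qfree_true /a_qfree_step /a_states.
rewrite /a_bind_trace /a_bind_prop /a_trace /a_val /a_prop /a_var /a_table.
rewrite /a_env /a_push /sat_certificate.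
by repeat sat_step.
Qed.

Lemma a_satisfiability_closed : arith_closed [:: 0] [::] a_satisfiability.
Proof. by []. Qed.

Lemma sat_a_satisfiability n (Y : 'I_2 -> set (set nat)) :
  arith_sat (update (fun=> 0) 0 n) (fun=> set0) Y a_satisfiability <->
  sat_certificate (Y ord0) (Y ord_max) n.
Proof.
have prelude z u K : arith_sat (update (update (update (fun=> 0) 0 n) 1 z) 2 u)
    (update (fun=> set0) 0 K) Y a_prelude <-> [/\ z = 0, u = 1 & K = pow_graph].
  have -> : arith_sat (update (update (update (fun=> 0) 0 n) 1 z) 2 u)
      (update (fun=> set0) 0 K) Y a_prelude <->
    z + z = z /\ u * u = u /\ z < u /\
    (forall x, K x -> x = pair_nat z u \/ exists a b, K (pair_nat a b) /\
       x = pair_nat (a + u) (b + b)) /\ K (pair_nat z u) /\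
    forall a b, K (pair_nat a b) -> K (pair_nat (a + u) (b + b)).
    by rewrite /a_prelude; repeat sat_step.
  split.
    move=> [zE [uE [zu [K1 [K0 KS]]]]].
    have z0 : z = 0 by lia.
    have u1 : u = 1 by nia.
    split=> //; rewrite {}z0 {}u1 in K1 K0 KS.
    (* A member other than the pair (0, 1) comes from a member that is a smaller number, so
       induction rules out spurious members. *)
    have Kx x : K x -> pow_graph x.
      elim/ltn_ind: x => x IH /K1 [->|[a [b [Kab xE]]]]; first by exists 0.
      have [|a' /pair_nat_inj [aE bE]] := IH _ _ Kab.
        by rewrite xE /pair_nat; nia.
      by exists a'.+1; rewrite xE aE bE addn1 addnn expnS mul2n.
    apply/seteqP; split=> // _ [a ->]; elim: a => // a IH.
    by have := KS _ _ IH; rewrite addn1 addnn expnS mul2n.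
  move=> [-> -> ->]; do 3!split=> //; split; last split.
  - move=> _ [[|a] ->]; [by left|right]; exists a, (2 ^ a).
    by split; [exists a|rewrite addn1 addnn expnS mul2n].
  - by exists 0.
  - move=> a b [a' /pair_nat_inj [-> ->]]; exists a'.+1.
    by rewrite addn1 addnn expnS mul2n.
rewrite -(sat_a_certificate n Y).
apply: iff_trans (sat_AEx1 (fun z => sat_AEx1 (fun u => sat_AEx2 (fun K =>
  sat_AAnd (prelude z u K) (iff_refl _))))) _.
split; first by move=> [z [u [K [[-> -> ->]]]]].
by exists 0, 1, pow_graph.
Qed.

(** * Correctness of the certificate *)

Section Semantics.
Variables (m : nat) (Y0 : set (set nat)).
Hypothesis Y0_neq0 : exists X, Y0 X.
Local Notation AP := 'I_m.+1.
Implicit Types (E X : set nat) (psi : qfree AP) (phi : hyperqptl AP).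

Definition env_override E X : trace AP :=
  fun i => [set p : AP | `[< overridden E X i p >]]%SET.

Definition env_traces E : set (trace AP) := env_override E @` Y0.

Definition env_assign E : nat -> option (trace AP) :=
  fun v => Some (fun i => [set p : AP | `[< env_trace E v i p >]]%SET).

Definition env_scope E (vs : seq nat) (qs : seq AP) : Prop :=
  (forall v, env_var E v <-> v \in vs) /\ (forall q : AP, env_prop E q <-> q \in qs).

Ltac pairs := repeat match goal with
  | H : pair_nat _ _ = pair_nat _ _ |- _ => apply pair_nat_inj in H; destruct H
  end.

Lemma bind_traceE E v X :
  [/\ forall v', env_var (bind_trace E v X) v' <-> v' = v \/ env_var E v',
      forall q, env_prop (bind_trace E v X) q <-> env_prop E q,
      forall i q, env_val (bind_trace E v X) i q <-> env_val E i q &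
      forall v' i p, env_trace (bind_trace E v X) v' i p <->
        if v' == v then overridden E X i p else env_trace E v' i p].
Proof.
rewrite /env_var /env_prop /env_val /env_trace /bind_trace /=.
split=> [v'|q|i q|v' i p].
- split=> [[H|[[i [p [H _]]]|[H _]]]|[->|H]]; pairs; auto; try by [].
  by right; right; split=> // -[x H1]; pairs.
- split=> [[H|[[i [p [H _]]]|[H _]]]|H]; pairs; auto; try by [].
  by right; right; split=> // -[x H1]; pairs.
- split=> [[H|[[i' [p [H _]]]|[H _]]]|H]; pairs; auto; try by [].
  by right; right; split=> // -[x H1]; pairs.
- case: (eqVneq v' v) => [->|nv]; split.
  + move=> [H|[[i' [p' [H ov]]]|[_ H]]]; pairs; subst=> //.
    by case: H; eexists.
  + by move=> ov; right; left; exists i, p.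
  + move=> [H|[[i' [p' [H ov]]]|[H _]]]; pairs; subst=> //.
    by rewrite eqxx in nv.
  + move=> H; right; right; split=> // -[x H1]; pairs; subst.
    by rewrite eqxx in nv.
Qed.

Lemma bind_propE E q A :
  [/\ forall v, env_var (bind_prop E q A) v <-> env_var E v,
      forall q', env_prop (bind_prop E q A) q' <-> q' = q \/ env_prop E q',
      forall i q', env_val (bind_prop E q A) i q' <->
        if q' == q then A i else env_val E i q' &
      forall v i p, env_trace (bind_prop E q A) v i p <-> env_trace E v i p].
Proof.
rewrite /env_var /env_prop /env_val /env_trace /bind_prop /=.
split=> [v|q'|i q'|v i p].
- split=> [[H|[[i [H _]]|[H _]]]|H]; pairs; auto; try by [].
  by right; right; split=> // -[x H1]; pairs.
- split=> [[H|[[i [H _]]|[H _]]]|[->|H]]; pairs; auto; try by [].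
  by right; right; split=> // -[x H1]; pairs.
- case: (eqVneq q' q) => [->|nq]; split.
  + move=> [H|[[i' [H ov]]|[_ H]]]; pairs; subst=> //.
    by case: H; eexists.
  + by move=> ov; right; left; exists i.
  + move=> [H|[[i' [H ov]]|[H _]]]; pairs; subst=> //.
    by rewrite eqxx in nq.
  + move=> H; right; right; split=> // -[x H1]; pairs; subst.
    by rewrite eqxx in nq.
- split=> [[H|[[i' [H _]]|[H _]]]|H]; pairs; auto; try by [].
  by right; right; split=> // -[x H1]; pairs.
Qed.

Lemma state_set_inj c c' E E' :
  state_set c E = state_set c' E' -> c = c' /\ E = E'.
Proof.
move=> /seteqP [H1 H2]; split.
  by have [H|[y [H _]]] := H1 (pair_nat 0 c) (or_introl erefl); pairs.
apply/seteqP; split=> x Ex.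
  have [|H|[y [H Ey]]] := H1 (pair_nat 1 x); first by right; exists x.
    by pairs.
  by pairs; subst.
have [|H|[y [H Ey]]] := H2 (pair_nat 1 x); first by right; exists x.
  by pairs.
by pairs; subst.
Qed.

Lemma env_traces_bind_trace E v X :
  env_traces (bind_trace E v X) = env_traces E.
Proof.
rewrite /env_traces; congr (_ @` _); apply/funext => X'; apply/funext => i.
have [_ pE vE _] := bind_traceE E v X.
by apply/setP => p; rewrite !inE; apply: asbool_equiv_eq; rewrite /overridden pE vE.
Qed.

Lemma env_assign_bind_trace E v X :
  env_assign (bind_trace E v X) = update (env_assign E) v (Some (env_override E X)).
Proof.
have [_ _ _ tE] := bind_traceE E v X.
apply/funext => v'; rewrite /env_assign /update /env_override.
case: eqP => [->|/eqP/negbTE nv]; congr Some; apply/funext => i; apply/setP => p.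
  by rewrite !inE; apply: asbool_equiv_eq; rewrite tE eqxx.
by rewrite !inE; apply: asbool_equiv_eq; rewrite tE nv.
Qed.

Lemma env_traces_bind_prop E (q : AP) A : env_traces (bind_prop E q A) =
  trace_subst q (fun i => `[< A i >]) @` env_traces E.
Proof.
have [_ pE vE _] := bind_propE E q A.
rewrite /env_traces image_comp; congr (_ @` _).
apply/funext => X'; apply/funext => i; apply/setP => p.
rewrite inE /= /trace_subst.
case: (eqVneq p q) => [->|npq].
  apply/asboolP/idP; rewrite /overridden pE vE eqxx.
    by move=> [[_ /asboolP ->]|[[]]]; rewrite ?inE ?eqxx //; left.
  by case: asboolP; rewrite !inE eqxx //= => HA _; left; split=> //; left.
have nv : (p == q :> nat) = false by apply/negbTE.
rewrite (_ : (p \in _) = (p \in env_override E X' i)); last first.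
  by case: ifP => _; rewrite !inE (negbTE npq).
rewrite inE; apply: asbool_equiv_eq; rewrite /overridden vE nv.
have -> : env_prop (bind_prop E q A) p <-> env_prop E p.
  by rewrite pE; split=> [[/eqP|]|]; rewrite ?nv; auto.
by [].
Qed.

Lemma env_assign_bind_prop E q A : env_assign (bind_prop E q A) = env_assign E.
Proof.
have [_ _ _ tE] := bind_propE E q A.
apply/funext => v; congr Some; apply/funext => i; apply/setP => p.
by rewrite !inE; apply: asbool_equiv_eq; rewrite tE.
Qed.

Lemma env_scope_bind_trace E v X vs qs : env_scope E vs qs ->
  env_scope (bind_trace E v X) (v :: vs) qs.
Proof.
have [xE pE _ _] := bind_traceE E v X => -[H1 H2]; split=> [v'|q].
  by rewrite xE H1 inE; split=> [[->|->]|/orP[/eqP|]]; rewrite ?eqxx ?orbT; auto.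
by rewrite pE H2.
Qed.

Lemma env_scope_bind_prop E (q : AP) A vs qs : env_scope E vs qs ->
  env_scope (bind_prop E q A) vs (q :: qs).
Proof.
have [xE pE _ _] := bind_propE E q A => -[H1 H2]; split=> [v|q'].
  by rewrite xE H1.
rewrite pE H2 inE; split=> [[/val_inj ->|->]|/orP[/eqP ->|]];
  rewrite ?eqxx ?orbT; auto.
Qed.

Local Notation qsat E i psi := (qfree_sat (env_traces E) (env_assign E) i psi).
Local Notation hsat E phi := (hyperqptl_sat (env_traces E) (env_assign E) 0 phi).

Lemma qsat_lab E i (p : AP) v : qsat E i (QLab p v) <-> env_trace E v i p.
Proof.
split=> [[t [<-]]|H]; first by rewrite inE => /asboolP.
by eexists; first reflexivity; rewrite inE; apply/asboolP.
Qed.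

Lemma qsat_prop E i (q : AP) : env_prop E q ->
  qsat E i (QProp q) <-> env_val E i q.
Proof.
move=> Eq; split=> /= [H|H _ [X _ <-]]; last by rewrite inE; apply/asboolP; left.
have [X YX] := Y0_neq0; have := H _ (imageP _ YX).
by rewrite inE => /asboolP [[]|[]].
Qed.

Definition truth_value b (P : Prop) : Prop := b = 1 /\ P \/ b = 0 /\ ~ P.

Lemma truth_value_exists P : exists b, truth_value b P.
Proof. by case: (EM P) => H; [exists 1; left|exists 0; right]. Qed.

Lemma qfree_step_sound E S vs qs : env_scope E vs qs ->
  (forall c d i b, in_table S c d i b -> qfree_step m E S c d i b) ->
  forall c d i b s, in_table S c d i b -> d = seq_code s ->
  exists psi, [/\ c = seq_code (qfree_polish psi ++ s), qfree_closed vs qs psi &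
                  truth_value b (qsat E i psi)].
Proof.
move=> [sV sQ] HS; elim/ltn_ind=> c IH d i b s Sc dE; have := HS _ _ _ _ Sc.
rewrite {}dE in Sc *.
case=> [[p [v [c1 [c2 [h0 [hp [hv [ltp [Ev H]]]]]]]]]|].
  move: hv hp h0 => /push_codeP -> /push_codeP -> /push_codeP ->.
  rewrite addn1 in ltp; exists (QLab (Ordinal ltp) v); split=> //=; first exact/sV.
  have LE := qsat_lab E i (Ordinal ltp) v.
  by case: H => -[-> H]; [left|right]; split=> //; [apply/LE|move/LE].
case=> [[q [c1 [h1 [hq [ltq [Eq H]]]]]]|].
  move: hq h1 => /push_codeP -> /push_codeP ->.
  rewrite addn1 in ltq; exists (QProp (Ordinal ltq)); split=> //=.
    exact/(sQ (Ordinal ltq)).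
  have := @qsat_prop E i (Ordinal ltq) Eq => QE.
  by case: H => -[-> H]; [left|right]; split=> //; [apply/QE|move/QE].
case=> [[c1 [b1 [h2 [S1 bE]]]]|].
  have lt1 : c1 < c by have := push_code_eq h2; lia.
  have [psi [cE cl H]] := IH _ lt1 _ _ _ _ S1 erefl.
  rewrite cE in h2; exists (QNeg psi); split=> //=; first exact/push_codeP.
  by case: H => -[b1E H]; [right|left]; split=> //; lia.
case=> [[c1 [c2 [b1 [b2 [h3 [lt2 [S1 [S2 H]]]]]]]]|].
  have lt1 : c1 < c by have := push_code_eq h3; lia.
  (* The split point [c2] is guessed; the explicit bound [c2 < c] in the clause makes the induction
     apply. The right operand is decoded first, since only this shows that [c2] is a code, as the
     left operand requires. *)
  have [psi2 [c2E cl2 H2]] := IH _ lt2 _ _ _ _ S2 erefl.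
  have [psi1 [c1E cl1 H1]] := IH _ lt1 _ _ _ _ S1 c2E.
  rewrite c1E in h3; exists (QOr psi1 psi2); split; rewrite /= ?cl1 ?cl2 //.
    by rewrite -catA; apply/push_codeP.
  case: H => [[-> H]|[-> [b1E b2E]]].
    left; split=> //.
    by case: H => bE; [left; case: H1|right; case: H2] => -[E1 //]; rewrite bE in E1.
  right; split=> // -[K|K]; [case: H1|case: H2] => -[E1 //].
    by rewrite b1E in E1.
  by rewrite b2E in E1.
case=> [[c1 [h4 S1]]|].
  have lt1 : c1 < c by have := push_code_eq h4; lia.
  have [psi [cE cl H]] := IH _ lt1 _ _ _ _ S1 erefl.
  rewrite cE in h4; exists (QNext psi); split=> //=; first exact/push_codeP.
  by move: H; rewrite [i + 1]addn1.
move=> [c1 [h5 H]].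
have lt1 : c1 < c by have := push_code_eq h5; lia.
case: H => [[-> [j [ltj Sj]]]|[-> H]].
  have [psi [cE cl Hj]] := IH _ lt1 _ _ _ _ Sj erefl.
  rewrite cE in h5; exists (QEventually psi); split=> //=; first exact/push_codeP.
  by left; split=> //; exists j; [lia|case: Hj => -[]].
have lei j : i <= j -> i < j + 1 by rewrite addn1.
have [psi [cE cl _]] := IH _ lt1 _ _ _ _ (H i (lei i (leqnn i))) erefl.
rewrite cE in h5; exists (QEventually psi); split=> //=; first exact/push_codeP.
right; split=> // -[j ij Hj].
(* Each position yields its own decoded formula; unique readability shows that it is always
   [psi]. *)
have [psi' [cE' _ H']] := IH _ lt1 _ _ _ _ (H j (lei j ij)) erefl.
move: cE'; rewrite cE => /seq_code_inj /qfree_polish_inj [psiE _].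
by rewrite -psiE in H'; case: H' => -[].
Qed.

Lemma qfree_step_complete E vs qs psi : env_scope E vs qs ->
  qfree_closed vs qs psi -> qsat E 0 psi ->
  qfree_true m E (seq_code (qfree_polish psi)).
Proof.
move=> [sV sQ] cl Hpsi.
(* All closed formulas with all continuations are tabulated at once, which makes the table stable
   under passing to operands. *)
pose S : set nat := [set x | exists psi s i b,
  [/\ x = pair_nat (seq_code (qfree_polish psi ++ s))
             (pair_nat (seq_code s) (pair_nat i b)),
      qfree_closed vs qs psi & truth_value b (qsat E i psi)]].
have SI psi' s i b : qfree_closed vs qs psi' -> truth_value b (qsat E i psi') ->
    in_table S (seq_code (qfree_polish psi' ++ s)) (seq_code s) i b.
  by move=> cl' H; exists psi', s, i, b.
exists S; split.
  by have := @SI psi [::] 0 1 cl; rewrite cats0; apply; left.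
move=> {psi cl Hpsi} c d i b [psi [s [i' [b' [E0 cl H]]]]]; pairs; subst.
have codeI a s' : push_code a (seq_code (a :: s')) (seq_code s') by apply/push_codeP.
case: psi cl H => [p v|q|psi|psi1 psi2|psi|psi] /= cl H.
- left; exists p, v; do 2!eexists; do 3!(split; first exact: codeI).
  rewrite addn1 ltn_ord; split=> //; split; first exact/sV.
  by move: H; rewrite /truth_value -/(qsat E i' (QLab p v)) qsat_lab.
- right; left; exists q; eexists; do 2!(split; first exact: codeI).
  have Eq : env_prop E q by apply/sQ.
  rewrite addn1 ltn_ord; split=> //; split=> //.
  by move: H; rewrite /truth_value -/(qsat E i' (QProp q)) qsat_prop.
- do 2!right; left; have [b1 H1] := truth_value_exists (qsat E i' psi).
  eexists; exists b1; split; first exact: codeI.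
  split; first exact: SI.
  by case: H H1 => -[-> H] [[-> H1]|[-> H1]].
- do 3!right; left; move: cl => /andP[cl1 cl2].
  have [b1 H1] := truth_value_exists (qsat E i' psi1).
  have [b2 H2] := truth_value_exists (qsat E i' psi2).
  rewrite -catA; eexists; exists (seq_code (qfree_polish psi2 ++ s)), b1, b2.
  split; first exact: codeI.
  split.
    exact: leq_ltn_trans (seq_code_cat_le _ _) (seq_code_cons_lt _ _).
  split; first exact: SI.
  split; first exact: SI.
  by rewrite /truth_value in H H1 H2; intuition.
- do 4!right; left; eexists; split; first exact: codeI.
  by rewrite addn1; apply: SI.
- do 5!right; eexists; split; first exact: codeI.
  case: H => -[-> H]; [left|right]; split=> //.
    by case: H => j ij Hj; exists j; split; [lia|apply: SI => //; left].
  move=> j ij; apply: SI => //; right; split=> // Hj; apply: H; exists j => //; lia.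
Qed.

Lemma hyperqptl_step_sound Y1 :
  (forall c E, in_states Y1 c E -> hyperqptl_step m Y0 Y1 c E) ->
  forall c E vs qs, env_scope E vs qs -> Y1 (state_set c E) ->
  exists phi, [/\ c = seq_code (hyperqptl_polish phi),
                  hyperqptl_closed vs qs phi & hsat E phi].
Proof.
move=> HY; elim/ltn_ind=> c IH E vs qs sc.
(* The strict decrease comes from the tag: [v] may be 0, in which case stripping it need not lower
   the number. *)
have lt2 a v c1 c2 : 1 < a -> push_code a c c1 -> push_code v c1 c2 -> c2 < c.
  move=> a1 /push_code_eq h1 /push_code_eq h2.
  have : 0 < 2 ^ v by rewrite expn_gt0.
  have : 2 ^ 2 <= 2 ^ a by rewrite leq_exp2l.
  by nia.
move/in_statesE/HY; case=> [[v [c1 [c2 [h6 [hv [X [YX]]]]]]]|].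
  move/in_statesE/(IH _ (lt2 6 _ _ _ isT h6 hv) _ _ _ (env_scope_bind_trace v X sc)).
  move=> [phi [cE cl]]; rewrite env_traces_bind_trace env_assign_bind_trace => H.
  exists (HExTrace v phi); split=> //=.
    by move: hv h6; rewrite cE => /push_codeP -> /push_codeP.
  by exists (env_override E X) => //; exact: imageP.
case=> [[v [c1 [c2 [h7 [hv H]]]]]|].
  have {}H X : Y0 X -> exists phi, [/\ c2 = seq_code (hyperqptl_polish phi),
      hyperqptl_closed (v :: vs) qs phi & hyperqptl_sat (env_traces E)
      (update (env_assign E) v (Some (env_override E X))) 0 phi].
    move=> /H/in_statesE.
    move/(IH _ (lt2 7 _ _ _ isT h7 hv) _ _ _ (env_scope_bind_trace v X sc)).
    by rewrite env_traces_bind_trace env_assign_bind_trace.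
  (* Nonemptiness of the set of traces provides a formula at all; the other traces give formulas
     with the same code, hence the same formula. *)
  have [X0 YX0] := Y0_neq0; have [phi [cE cl _]] := H X0 YX0.
  exists (HAllTrace v phi); split=> //=.
    by move: hv h7; rewrite cE => /push_codeP -> /push_codeP.
  move=> _ [X YX <-]; have [phi' [cE' _ H']] := H X YX.
  by move: cE' H'; rewrite cE => /seq_code_inj /hyperqptl_polish_inj <-.
case=> [[q [c1 [c2 [h8 [hq [ltq [A]]]]]]]|].
  rewrite addn1 in ltq; pose q' := Ordinal ltq.
  move/in_statesE.
  move/(IH _ (lt2 8 _ _ _ isT h8 hq) _ _ _ (env_scope_bind_prop q' A sc)).
  move=> [phi [cE cl]].
  rewrite (env_traces_bind_prop E q') env_assign_bind_prop => H.
  exists (HExProp q' phi); split=> //=; last by eexists; exact: H.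
  by move: hq h8; rewrite cE => /push_codeP -> /push_codeP.
case=> [[q [c1 [c2 [h9 [hq [ltq H]]]]]]|].
  rewrite addn1 in ltq; pose q' := Ordinal ltq.
  have {}H A : exists phi, [/\ c2 = seq_code (hyperqptl_polish phi),
      hyperqptl_closed vs (q' :: qs) phi & hyperqptl_sat
      (trace_subst q' (fun i => `[< A i >]) @` env_traces E) (env_assign E) 0 phi].
    have /in_statesE := H A.
    move/(IH _ (lt2 9 _ _ _ isT h9 hq) _ _ _ (env_scope_bind_prop q' A sc)).
    by rewrite (env_traces_bind_prop E q') env_assign_bind_prop.
  have [phi [cE cl _]] := H set0.
  exists (HAllProp q' phi); split=> //=.
    by move: hq h9; rewrite cE => /push_codeP -> /push_codeP.
  move=> tq; have [phi' [cE' _ H']] := H [set i | tq i].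
  move: cE' H'; rewrite cE => /seq_code_inj /hyperqptl_polish_inj <-.
  by rewrite (_ : (fun i => _) = tq) //; apply/funext => i; rewrite asboolb.
move=> [S [Sc HS]].
have [psi [cE cl H]] := qfree_step_sound sc HS Sc (erefl : 1 = seq_code [::]).
exists (HQfree psi); split=> //=; first by rewrite cE cats0.
by case: H => -[].
Qed.

Definition sat_states : set (set nat) := [set Z | exists phi E vs qs,
  [/\ Z = state_set (seq_code (hyperqptl_polish phi)) E, env_scope E vs qs,
      hyperqptl_closed vs qs phi & hsat E phi]].

Lemma hyperqptl_step_complete c E :
  in_states sat_states c E -> hyperqptl_step m Y0 sat_states c E.
Proof.
move=> /in_statesE [phi [E' [vs [qs [/state_set_inj [-> ->] sc cl H]]]]] {c E}.
have codeI a s : push_code a (seq_code (a :: s)) (seq_code s) by apply/push_codeP.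
case: phi cl H => [v phi|v phi|q phi|q phi|psi] /= cl H.
- left; do 3!eexists; do 2!(split; first exact: codeI).
  have [_ [X YX <-] HX] := H; exists X; split=> //; apply/in_statesE.
  exists phi, (bind_trace E' v X), (v :: vs), qs; split=> //.
    exact: env_scope_bind_trace.
  by rewrite env_traces_bind_trace env_assign_bind_trace.
- right; left; do 3!eexists; do 2!(split; first exact: codeI).
  move=> X YX; apply/in_statesE.
  exists phi, (bind_trace E' v X), (v :: vs), qs; split=> //.
    exact: env_scope_bind_trace.
  rewrite env_traces_bind_trace env_assign_bind_trace; apply: H.
  exact: imageP.
- do 2!right; left; do 3!eexists; do 2!(split; first exact: codeI).
  rewrite addn1 ltn_ord; split=> //; have [tq Hq] := H; exists [set i | tq i].
  apply/in_statesE; exists phi, (bind_prop E' q [set i | tq i]), vs, (q :: qs).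
  split=> //; first exact: env_scope_bind_prop.
  rewrite env_traces_bind_prop env_assign_bind_prop.
  by rewrite (_ : (fun i => _) = tq) //; apply/funext => i; rewrite asboolb.
- do 3!right; left; do 3!eexists; do 2!(split; first exact: codeI).
  rewrite addn1 ltn_ord; split=> // A.
  apply/in_statesE; exists phi, (bind_prop E' q A), vs, (q :: qs).
  split=> //; first exact: env_scope_bind_prop.
  by rewrite env_traces_bind_prop env_assign_bind_prop; apply: H.
- by do 4!right; apply: qfree_step_complete sc cl H.
Qed.

End Semantics.

(** Identifies an unbound variable with one bound to the empty trace, as no labelled proposition
    holds in either case. This relates [env_assign], which is total, to the initial assignment of
    [models]. *)
Definition assign_equiv (AP : finType) (Pi Pi' : nat -> option (trace AP)) : Prop :=
  forall v j p, (exists2 t, Pi v = Some t & p \in t j) <->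
                (exists2 t, Pi' v = Some t & p \in t j).

Lemma assign_equiv_update (AP : finType) (Pi Pi' : nat -> option (trace AP)) v t :
  assign_equiv Pi Pi' -> assign_equiv (update Pi v (Some t)) (update Pi' v (Some t)).
Proof. by move=> H v' j p; rewrite /update; case: ifP. Qed.

Lemma hyperqptl_sat_assign (AP : finType) (T : set (trace AP)) Pi Pi' i
    (phi : hyperqptl AP) : assign_equiv Pi Pi' ->
  hyperqptl_sat T Pi i phi <-> hyperqptl_sat T Pi' i phi.
Proof.
elim: phi T Pi Pi' => [v phi IH|v phi IH|q phi IH|q phi IH|psi] T Pi Pi' H /=.
- by split=> -[t Tt Ht]; exists t => //; move: Ht; have := assign_equiv_update v t H;
    move/(IH T) => [].
- by split=> Ht t Tt; move: (Ht t Tt); have := assign_equiv_update v t H;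
    move/(IH T) => [].
- by split=> -[tq Ht]; exists tq; move: Ht;
    have [] := IH (trace_subst q tq @` T) _ _ H.
- by split=> Ht tq; move: (Ht tq); have [] := IH (trace_subst q tq @` T) _ _ H.
elim: psi i => //=.
- by move=> psi IH i; rewrite IH.
- by move=> psi1 IH1 psi2 IH2 i; rewrite IH1 IH2.
- by move=> psi IH i; split=> -[j ij /IH Hj]; exists j.
Qed.

Lemma models_env_assign m Y0 (phi : hyperqptl 'I_m.+1) :
  hyperqptl_sat (@env_traces m Y0 set0) (@env_assign m set0) 0 phi <->
  models (@env_traces m Y0 set0) phi.
Proof.
apply: hyperqptl_sat_assign => v j p; split=> [[t [<-]]|[]] //.
by rewrite inE => /asboolP.
Qed.

Lemma hyperqptl_satisfiabilityP n : hyperqptl_satisfiability n <->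
  exists Y : 'I_2 -> set (set nat), sat_certificate (Y ord0) (Y ord_max) n.
Proof.
have scope0 m : env_scope (m := m) set0 [::] [::] by [].
split.
  move=> [m [phi [sphi -> [T [t0 Tt0] HT]]]].
  pose enc (t : trace 'I_m.+1) : set nat :=
    [set x | exists i (p : 'I_m.+1), x = pair_nat i p /\ p \in t i].
  pose Y0 : set (set nat) := enc @` T.
  have Y0_neq0 : exists X, Y0 X by exists (enc t0); exact: imageP.
  have TE : @env_traces m Y0 set0 = T.
    rewrite /env_traces /Y0 image_comp (_ : _ \o _ = id) ?image_id //.
    apply/funext => t; apply/funext => i; apply/setP => p; rewrite inE.
    apply/asboolP/idP => [[[]|[_ [i' [p' [/pair_nat_inj [-> /val_inj ->]]]]]]|pt] //.
    by right; split=> //; exists i, p.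
  exists (fun j => if j == ord0 then Y0 else sat_states m Y0); split=> //=.
  exists m, (seq_code (hyperqptl_polish phi)); split; first exact/push_codeP.
  split; last by move=> c E; apply: hyperqptl_step_complete.
  exists set0; split=> [x []|]; apply/in_statesE.
  exists phi, set0, [::], [::]; split=> //.
  by apply/models_env_assign; rewrite TE.
move=> [Y [Y0_neq0 [m [c [hn [[E [E0 Hc]] HY]]]]]].
have {}E0 : E = set0 by apply/seteqP; split=> x // /E0.
rewrite {}E0 in Hc; move: Hc => /in_statesE.
move=> /(hyperqptl_step_sound Y0_neq0 HY (scope0 m)).
move=> [phi [cE cl /models_env_assign Hphi]].
exists m, phi; split=> //.
  by move: hn; rewrite cE => /push_codeP.
exists (@env_traces m (Y ord0) set0) => //.
by have [X YX] := Y0_neq0; exists (@env_override m set0 X); exact: imageP.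
Qed.

Lemma hyperqptl_in_Sigma21 : Sigma21 hyperqptl_satisfiability.
Proof.
exists 2, a_satisfiability; split; first exact: a_satisfiability_closed.
apply/funext => n; apply/propext; rewrite hyperqptl_satisfiabilityP /=.
by split=> -[Y HY]; exists Y; apply/sat_a_satisfiability.
Qed.

Theorem theorem4 : Sigma21_complete hyperqptl_satisfiability.
Proof. by split; [exact: hyperqptl_in_Sigma21 | exact: hyperqptl_hard]. Qed.
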